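(* Let $(d_1,\dots,d_n)$, in non-decreasing order, be the symplectic spectrum of some Gaussian state of $n$ modes (i.e. $1\le d_1\le\dots\le d_n$). Let $\rho_1,\dots,\rho_n$ be single-mode Gaussian states with symplectic spectra $\mathrm{sspec}(\rho_k)=c_k$, labelled such that $c_1\le\dots\le c_n$. Then there exists a Gaussian state $\rho$ of $n$ modes with $\mathrm{sspec}(\rho)=(d_1,\dots,d_n)$ whose reduced state to the $k$-th mode is $\rho_k$ for every $k=1,\dots,n$ if and only if $$\sum_{j=1}^k c_j \;\ge\; \sum_{j=1}^k d_j\quad (k=1,\dots,n)\qquad\text{and}\qquad c_n-\sum_{j=1}^{n-1}c_j \;\le\; d_n-\sum_{j=1}^{n-1}d_j .$$
   Context: For $n$ bosonic modes with canonical coordinates $R=(x_1,p_1,\dots,x_n,p_n)$, $[R_j,R_k]=i\sigma_{jk}$, $\sigma=\bigoplus_{k=1}^n\begin{pmatrix}0&1\\-1&0\end{pmatrix}$, a Gaussian state $\rho$ is a quantum state with Gaussian characteristic function; it is determined by its vector of first moments $\mu_j=\mathrm{tr}(\rho R_j)\in\mathbb{R}^{2n}$ (arbitrary) and its real symmetric $2n\times 2n$ covariance matrix $\gamma_{jk}=\mathrm{tr}(\rho\{R_j-\mu_j,R_k-\mu_k\})$ (so the vacuum has $\gamma=\mathbb{1}$). The covariance matrices of Gaussian states are exactly the real symmetric matrices with $\gamma+i\sigma\ge 0$. The reduced state of a Gaussian state to the $k$-th mode is the Gaussian state whose covariance matrix is the $k$-th $2\times2$ main diagonal block of $\gamma$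 (rows and columns $2k-1,2k$) and whose first moments are $(\mu_{2k-1},\mu_{2k})$. The symplectic spectrum $\mathrm{sspec}(\rho)$ of a Gaussian state is the symplectic spectrum of its covariance matrix: the numbers $(d_1,\dots,d_n)$ such that $S\gamma S^T=\mathrm{diag}(d_1,d_1,\dots,d_n,d_n)$ for some $S\in\mathrm{Sp}(2n,\mathbb{R})=\{S\in\mathbb{R}^{2n\times 2n}:S\sigma S^T=\sigma\}$. For a single mode it is the single number $\sqrt{\det\gamma}$. Empty sums are $0$. *)

(* Defs.v *)
From HB Require Import structures.
From mathcomp Require Import all_boot all_order all_algebra.
From mathcomp Require Import boolp reals.
From mathcomp Require Import complex.

Set Implicit Arguments.
Unset Strict Implicit.
Unset Printing Implicit Defensive.

Import Order.TTheory GRing.Theory Num.Theory.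
Local Open Scope ring_scope.
Local Open Scope sesquilinear_scope.

(* Phase space of n modes, with coordinates ordered (x_1, p_1, ..., x_n, p_n).
   Writing 2n as a sum of n blocks of size 2 makes the single-mode blocks
   accessible through mxdiag, submxblock and submxcol. *)
Notation phase_dim n := (\sum_(k < n) 2)%N.

Section PhaseSpace.
Variable R : realType.

Definition omega : 'M[R]_2 := delta_mx 0 1 - delta_mx 1 0.

Definition sigma n : 'M[R]_(phase_dim n) := \mxdiag_(k < n) omega.

Definition symplectic n (S : 'M[R]_(phase_dim n)) : Prop :=
  S *m sigma n *m S^T = sigma n.

(* The order on R[i] makes 0 <= z mean that z is real and nonnegative, so this
   also forces M to be Hermitian. *)
Definition psdmx m (M : 'M[R[i]]_m) : Prop :=
  forall v : 'cV[R[i]]_m, 0 <= (v ^t* *m M *m v) 0 0.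

Definition uncertainty n (g : 'M[R]_(phase_dim n)) : 'M[R[i]]_(phase_dim n) :=
  map_mx (real_complex R) g + 'i%C *: map_mx (real_complex R) (sigma n).

(* A Gaussian state is identified with its first and second moments.  With
   cov j k = tr (rho {R_j - mu_j, R_k - mu_k}), the vacuum has cov = 1, and the
   pairs (mean, cov) below are exactly the moments of Gaussian states. *)
Record gaussian_state n := GaussianState {
  mean : 'cV[R]_(phase_dim n);
  cov : 'M[R]_(phase_dim n);
  cov_sym : cov^T = cov;
  cov_uncertainty : psdmx (uncertainty cov)
}.

Definition reduced_mean n (mu : 'cV[R]_(phase_dim n)) (k : 'I_n) :
    'cV[R]_(phase_dim 1) :=
  \mxcol_(i < 1) submxcol mu k.

Definition reduced_cov n (g : 'M[R]_(phase_dim n)) (k : 'I_n) :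
    'M[R]_(phase_dim 1) :=
  \mxdiag_(i < 1) submxblock g k k.

Definition mode_index n (k : 'I_n) (i : 'I_(phase_dim 1)) : 'I_(phase_dim n) :=
  @tagnat.Rank n (fun=> 2) k (tagnat.sig2 i).

Lemma reduced_covE n (g : 'M[R]_(phase_dim n)) (k : 'I_n) :
  reduced_cov g k = mxsub (mode_index k) (mode_index k) g.
Proof.
apply/matrixP => i j; rewrite !mxE.
case: eqP => [e|]; last by rewrite !ord1.
by rewrite conform_mx_id !mxE.
Qed.

Lemma reduced_sigma n (k : 'I_n) : reduced_cov (sigma n) k = sigma 1.
Proof. by apply/eq_mxdiag => i; rewrite submxblock_diag. Qed.

Lemma psdmx_sub m p (f : 'I_p -> 'I_m) (M : 'M[R[i]]_m) :
  psdmx M -> psdmx (mxsub f f M).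
Proof.
move=> M0 v; set E : 'M[R[i]]_(m, p) := colsub f 1%:M.
have EE : E ^t* *m M *m E = mxsub f f M.
  have -> : E ^t* = rowsub f 1%:M.
    apply/matrixP => i j; rewrite !mxE eq_sym.
    by case: eqP => _; rewrite ?rmorph1 ?rmorph0.
  by rewrite mul_rowsub_mx mul1mx mulmx_colsub mulmx1; apply/matrixP => i j; rewrite !mxE.
have := M0 (E *m v).
by rewrite trmx_mul map_mxM -EE !mulmxA.
Qed.

Lemma reduced_cov_sym n (rho : gaussian_state n) (k : 'I_n) :
  (reduced_cov (cov rho) k)^T = reduced_cov (cov rho) k.
Proof.
by rewrite reduced_covE; apply/matrixP => i j; rewrite !mxE -[in RHS]cov_sym mxE.
Qed.

Lemma reduced_cov_uncertainty n (rho : gaussian_state n) (k : 'I_n) :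
  psdmx (uncertainty (reduced_cov (cov rho) k)).
Proof.
rewrite /uncertainty -(reduced_sigma k) !reduced_covE !map_mxsub.
have := psdmx_sub (mode_index k)
  (@cov_uncertainty _ rho).
by congr psdmx; apply/matrixP => i j; rewrite !mxE.
Qed.

Definition reduced_state n (rho : gaussian_state n) (k : 'I_n) :
    gaussian_state 1 :=
  GaussianState (reduced_mean (mean rho) k)
    (reduced_cov_sym rho k) (reduced_cov_uncertainty rho k).

Lemma gaussian_state_eq n (rho tau : gaussian_state n) :
  mean rho = mean tau -> cov rho = cov tau -> rho = tau.
Proof.
case: rho tau => [m g s u] [m' g' s' u'] /= em eg.
by subst m' g'; rewrite (Prop_irrelevance s s') (Prop_irrelevance u u').
Qed.

(* The symplectic spectrum is only determined up to order: has_sspec rho d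
   holds for every ordering d of it. *)
Definition has_sspec n (rho : gaussian_state n) (d : 'I_n -> R) : Prop :=
  exists S : 'M[R]_(phase_dim n),
    symplectic S /\ S *m cov rho *m S^T = \mxdiag_(k < n) ((d k)%:M : 'M[R]_2).

End PhaseSpace.

(* Main.v *)
Require Import Defs.
From mathcomp Require Import all_boot all_order all_algebra.
From mathcomp Require Import reals.
From mathcomp Require Import ring lra zify.
From mathcomp Require Import boolp classical_sets topology normedtype derive.
From mathcomp Require Import complex.

(* Everything is reduced to two modes.  The covariance matrices with symplectic
   spectrum d are the matrices S D S^T with S symplectic and D = diag(d, d), in
   coordinates that list all positions before all momenta.

   Two-mode normal form: local rotations make the correlation block diag(x, y),
   and the matrices [[a, x], [x, b]] and [[a, y], [y, b]] are then brought to a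
   common diag(p, q) by L and L^-T.  The invariants
     p^2 + q^2 = a^2 + b^2 + 2 x y,  p^2 q^2 = (a b - x^2) (a b - y^2)
   show that, for p <= q, the possible (a, b) are exactly those with
   p + q <= a + b and |a - b| <= q - p.

   Necessity: among all S D S^T whose 2 x 2 diagonal blocks are multiples of the
   identity and whose local spectra satisfy the asserted inequalities relative
   to c, minimise the sum of the partial sums of the local spectra (the set is
   compact because d >= 1).  Decoupling a correlated pair of modes would
   preserve the constraints and decrease the objective, so at the minimum
   S D S^T is diagonal.  Then S is orthogonal, the minimal local spectrum is the
   image of d under a doubly stochastic matrix, and the inequalities follow.

   Sufficiency: by induction, a correlated state of two neighbouring modes of D
   produces the smallest c_1 together with a suitable second value; the
   remaining modes are still uncorrelated among themselves. *)

Set Implicit Arguments.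
Unset Strict Implicit.
Unset Printing Implicit Defensive.

Import Order.TTheory GRing.Theory Num.Theory.
Import numFieldNormedType.Exports.
Local Open Scope ring_scope.

(** * Matrices preserving a bilinear form *)

Section FormPreserving.
Variables (R : fieldType) (m : nat) (J : 'M[R]_m).
Implicit Types S T : 'M[R]_m.

(** The form is arbitrary so that [Jmx], [sigma] and [omega] are covered at once. *)
Definition preserves S : Prop := S *m J *m S^T = J.

Lemma preserves_mul S T : preserves S -> preserves T -> preserves (S *m T).
Proof.
by move=> hS hT; rewrite /preserves trmx_mul !mulmxA -(mulmxA S) -(mulmxA S) hT.
Qed.

Hypothesis J_unit : J \in unitmx.

Lemma preserves_unit S : preserves S -> S \in unitmx.
Proof.
move=> hS; have /mulmx1_unit[] // : S *m (J *m S^T *m invmx J) = 1%:M.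
by rewrite !mulmxA hS mulmxV.
Qed.

Lemma preserves_inv S : preserves S -> preserves (invmx S).
Proof.
move=> hS; rewrite /preserves -[in LHS]hS trmx_inv !mulmxA mulVmx
  ?preserves_unit //.
by rewrite mul1mx mulmxK // unitmx_tr preserves_unit.
Qed.

End FormPreserving.

(** * Two modes *)

Section TwoByTwo.
Variable R : rcfType.
Implicit Types a b c s x y p q : R.

Definition mx2 a b c e : 'M[R]_2 :=
  \matrix_(i, j) if i == 0 then (if j == 0 then a else b)
                 else (if j == 0 then c else e).

Lemma mx2E a b c e :
  (mx2 a b c e 0 0 = a) * (mx2 a b c e 0 1 = b) *
  (mx2 a b c e 1 0 = c) * (mx2 a b c e 1 1 = e).
Proof. by rewrite !mxE. Qed.

Lemma mx2P (A B : 'M[R]_2) :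
  A 0 0 = B 0 0 -> A 0 1 = B 0 1 -> A 1 0 = B 1 0 -> A 1 1 = B 1 1 -> A = B.
Proof.
have h (i : 'I_2) : i = 0 \/ i = 1.
  by case: i => [[|[|k]] // lt_i]; [left|right]; apply: val_inj.
by move=> *; apply/matrixP => i j; case: (h i) => ->; case: (h j) => ->.
Qed.

Lemma mx2_mul a b c e a' b' c' e' :
  mx2 a b c e *m mx2 a' b' c' e' =
  mx2 (a * a' + b * c') (a * b' + b * e') (c * a' + e * c') (c * b' + e * e').
Proof. by apply: mx2P; rewrite !mxE big_ord_recl big_ord1 !mxE. Qed.

Lemma mx2_tr a b c e : (mx2 a b c e)^T = mx2 a c b e.
Proof. by apply: mx2P; rewrite mxE !mx2E. Qed.

Lemma mx2_1 : 1%:M = mx2 1 0 0 1.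
Proof. by apply: mx2P; rewrite mx2E mxE. Qed.

Lemma mx2_0 : 0 = mx2 0 0 0 0.
Proof. by apply: mx2P; rewrite mx2E mxE. Qed.

Lemma mx2D a b c e a' b' c' e' :
  mx2 a b c e + mx2 a' b' c' e' = mx2 (a + a') (b + b') (c + c') (e + e').
Proof. by apply: mx2P; rewrite mx2E mxE !mx2E. Qed.

Lemma mx2N a b c e : - mx2 a b c e = mx2 (- a) (- b) (- c) (- e).
Proof. by apply: mx2P; rewrite mx2E mxE !mx2E. Qed.

(** (c, s) is a unit eigenvector of [[m1, m], [m, m2]] for the smaller eigenvalue, and (-s, c) one
    for the larger. *)
Lemma sym2_diag_rot m1 m m2 : exists c s,
  [/\ c ^+ 2 + s ^+ 2 = 1, m * (c ^+ 2 - s ^+ 2) + (m2 - m1) * c * s = 0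
    & m1 * c ^+ 2 + m *+ 2 * c * s + m2 * s ^+ 2
      <= m1 * s ^+ 2 - m *+ 2 * c * s + m2 * c ^+ 2].
Proof.
have [->|m_neq0] := eqVneq m 0.
  case: (leP m1 m2) => h; [exists 1, 0 | exists 0, 1]; split; first [ring|lra].
pose w := Num.sqrt ((m1 - m2) ^+ 2 + (m *+ 2) ^+ 2).
have w2 : w ^+ 2 = (m1 - m2) ^+ 2 + (m *+ 2) ^+ 2.
  by rewrite sqr_sqrtr // addr_ge0 ?sqr_ge0.
have w_ge0 : 0 <= w by rewrite sqrtr_ge0.
(* [m1 + t] is the smaller eigenvalue, (m, t) an eigenvector for it, and [t2] the characteristic
   equation. *)
pose t := (m2 - m1 - w) / 2.
have t2 : t ^+ 2 = m ^+ 2 + (m2 - m1) * t.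
  have -> : t ^+ 2 = ((m2 - m1) ^+ 2 - (m2 - m1) * w *+ 2 + w ^+ 2) / 4.
    by rewrite /t; field.
  by rewrite w2 /t; field.
have m2_gt0 : 0 < m ^+ 2 by rewrite exprn_even_gt0.
pose N := Num.sqrt (m ^+ 2 + t ^+ 2).
have N2 : N ^+ 2 = m ^+ 2 + t ^+ 2.
  by rewrite sqr_sqrtr // addr_ge0 ?sqr_ge0.
have N_gt0 : 0 < N by rewrite sqrtr_gt0 ltr_pwDl ?sqr_ge0.
have N_neq0 : N != 0 by rewrite gt_eqF.
exists (m / N), (t / N); split.
- have -> : (m / N) ^+ 2 + (t / N) ^+ 2 = (m ^+ 2 + t ^+ 2) / N ^+ 2 by field.
  by rewrite -N2 mulfV // expf_neq0.
- have -> : m * ((m / N) ^+ 2 - (t / N) ^+ 2) + (m2 - m1) * (m / N) * (t / N)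
     = m * (m ^+ 2 - t ^+ 2 + (m2 - m1) * t) / N ^+ 2 by field.
  by rewrite t2 [X in X / _](_ : _ = 0) ?mul0r //; ring.
rewrite -subr_ge0.
have -> : m1 * (t / N) ^+ 2 - m *+ 2 * (m / N) * (t / N) + m2 * (m / N) ^+ 2 -
  (m1 * (m / N) ^+ 2 + m *+ 2 * (m / N) * (t / N) + m2 * (t / N) ^+ 2)
  = ((m2 - m1) * (m ^+ 2 - t ^+ 2) - m ^+ 2 * t *+ 4) / N ^+ 2 by field.
apply: divr_ge0; last exact: sqr_ge0.
have -> : (m2 - m1) * (m ^+ 2 - t ^+ 2) - m ^+ 2 * t *+ 4
  = w * (m ^+ 2 + t ^+ 2).
  have -> : w = m2 - m1 - t *+ 2 by rewrite /t; field.
  have e : t * t ^+ 2 = t * (m ^+ 2 + (m2 - m1) * t) by rewrite t2.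
  by ring: e.
by rewrite mulr_ge0 // addr_ge0 ?sqr_ge0.
Qed.

(* A pair of quadratic forms A on positions and B on momenta is brought to a
   common diagonal form by L acting on positions and K = L^-T on momenta:
   factor A = C C^T and diagonalise C^T B C by a rotation. *)
Lemma two_mode_williamson a b x y :
    0 < a -> 0 < b -> x ^+ 2 < a * b -> y ^+ 2 < a * b ->
  exists L K : 'M[R]_2, exists p q,
  [/\ L *m K^T = 1%:M,
      L *m mx2 a x x b *m L^T = mx2 p 0 0 q,
      K *m mx2 a y y b *m K^T = mx2 p 0 0 q,
      0 < p <= q
    & p ^+ 2 + q ^+ 2 = a ^+ 2 + b ^+ 2 + x * y *+ 2 /\
      p ^+ 2 * q ^+ 2 = (a * b - x ^+ 2) * (a * b - y ^+ 2)].
Proof.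
move=> a_gt0 b_gt0 x_lt y_lt.
(* Entries of the Cholesky factor [[al, 0], [t, w]] of [[a, x], [x, b]]. *)
pose al := Num.sqrt a; pose t := x / al; pose w := Num.sqrt (b - t ^+ 2).
have al_gt0 : 0 < al by rewrite sqrtr_gt0.
have al_neq0 : al != 0 by rewrite gt_eqF.
have al2 : a = al ^+ 2 by rewrite sqr_sqrtr ?ltW.
have xE : x = al * t by rewrite /t; field.
have bt_gt0 : 0 < b - t ^+ 2.
  rewrite subr_gt0 /t expr_div_n -al2 ltr_pdivrMr //; lra.
have w_gt0 : 0 < w by rewrite sqrtr_gt0.
have w_neq0 : w != 0 by rewrite gt_eqF.
have bE : b = t ^+ 2 + w ^+ 2 by rewrite sqr_sqrtr ?ltW //; ring.
(* Entries of C^T B C, where C is the Cholesky factor and B = [[a, y], [y, b]]; its eigenvalues will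
   be p^2 and q^2. *)
pose m1 := a ^+ 2 + al * t * y *+ 2 + t ^+ 2 * b.
pose m := w * (al * y + t * b); pose m2 := w ^+ 2 * b.
have [c [s [cs1 mcs le12]]] := sym2_diag_rot m1 m m2.
set l1 := (X in X <= _) in le12; set l2 := (X in _ <= X) in le12.
have sum_l : l1 + l2 = m1 + m2.
  by rewrite -[RHS]mulr1 -cs1 /l1 /l2; ring.
have prod_l : l1 * l2 = (a * b - x ^+ 2) * (a * b - y ^+ 2).
  have -> : (a * b - x ^+ 2) * (a * b - y ^+ 2) = m1 * m2 - m ^+ 2.
    by rewrite /m1 /m2 /m xE bE al2; ring.
  have e : (m1 * m2 - m ^+ 2) * (c ^+ 2 + s ^+ 2) ^+ 2 = m1 * m2 - m ^+ 2.
    by rewrite cs1 expr1n mulr1.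
  rewrite -e.
  have -> : (m1 * m2 - m ^+ 2) * (c ^+ 2 + s ^+ 2) ^+ 2 =
     l1 * l2 - (m * (c ^+ 2 - s ^+ 2) + (m2 - m1) * c * s) ^+ 2.
    by rewrite /l1 /l2; ring.
  by rewrite mcs expr0n subr0.
have sumE : m1 + m2 = a ^+ 2 + b ^+ 2 + x * y *+ 2.
  by rewrite /m1 /m2 xE bE; ring.
have prod_gt0 : 0 < l1 * l2 by rewrite prod_l mulr_gt0 ?subr_gt0.
have sum_gt0 : 0 < l1 + l2.
  rewrite sum_l sumE; have := sqr_ge0 (x + y); have := sqr_ge0 (a - b); nra.
have l1_gt0 : 0 < l1 by nra.
have l2_gt0 : 0 < l2 by lra.
pose p := Num.sqrt l1; pose q := Num.sqrt l2.
have p_gt0 : 0 < p by rewrite sqrtr_gt0.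
have q_gt0 : 0 < q by rewrite sqrtr_gt0.
have p2 : p ^+ 2 = l1 by rewrite sqr_sqrtr ?ltW.
have q2 : q ^+ 2 = l2 by rewrite sqr_sqrtr ?ltW.
(* After the rotation the first form is 1 and the second diag(p^2, q^2); rescaling by diag(u, v) and
   by its inverse makes both diag(p, q). *)
pose u := Num.sqrt p; pose v := Num.sqrt q.
have u_neq0 : u != 0 by rewrite gt_eqF ?sqrtr_gt0.
have v_neq0 : v != 0 by rewrite gt_eqF ?sqrtr_gt0.
have u2 : u ^+ 2 = p by rewrite sqr_sqrtr ?ltW.
have v2 : v ^+ 2 = q by rewrite sqr_sqrtr ?ltW.
pose Q := mx2 c s (- s) c.
pose C := mx2 al 0 t w; pose Ci := mx2 al^-1 0 (- t / (al * w)) w^-1.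
have QQ : Q *m Q^T = 1%:M.
  by rewrite mx2_tr mx2_mul mx2_1; congr mx2; rewrite -?cs1; ring.
have CiC : Ci *m C = 1%:M.
  by rewrite mx2_mul mx2_1; congr mx2; field; rewrite ?al_neq0 ?w_neq0.
have CC : C *m C^T = mx2 a x x b.
  by rewrite mx2_tr mx2_mul; congr mx2; rewrite ?xE ?bE ?al2; ring.
have CBC : C^T *m mx2 a y y b *m C = mx2 m1 m m m2.
  by rewrite mx2_tr !mx2_mul; congr mx2; rewrite /m1 /m /m2 ?al2; ring.
have QMQ : Q *m mx2 m1 m m m2 *m Q^T = mx2 l1 0 0 l2.
  rewrite mx2_tr !mx2_mul; congr mx2; rewrite /l1 /l2 -?mcs; ring.
pose E := mx2 u 0 0 v; pose Ei := mx2 u^-1 0 0 v^-1.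
exists (E *m Q *m Ci), (Ei *m Q *m C^T), p, q; split.
- rewrite !trmx_mul trmxK !mulmxA -[X in X *m _ *m _]mulmxA CiC mulmx1.
  rewrite -(mulmxA E) QQ mulmx1 mx2_tr mx2_mul mx2_1.
  by congr mx2; field; rewrite ?u_neq0 ?v_neq0.
- rewrite -CC !trmx_mul !mulmxA.
  rewrite -(mulmxA _ Ci C) CiC mulmx1 -(mulmxA _ C^T) -trmx_mul CiC trmx1
    mulmx1.
  rewrite -(mulmxA E) QQ mulmx1 mx2_tr mx2_mul.
  by congr mx2; rewrite -?u2 -?v2; ring.
- rewrite !trmx_mul trmxK !mulmxA.
  rewrite -(mulmxA _ C^T) -(mulmxA _ _ C) CBC.
  rewrite -(mulmxA _ Q) -(mulmxA _ _ Q^T) QMQ mx2_tr !mx2_mul.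
  congr mx2; rewrite -?p2 -?q2 -?u2 -?v2; field; rewrite ?u_neq0 ?v_neq0 //.
- by rewrite p_gt0 ler_sqrt ?(ltW l2_gt0).
by rewrite p2 q2 sum_l prod_l sumE.
Qed.

End TwoByTwo.

(** * Symplectic matrices with positions listed before momenta, and decoupling of two modes *)

Section Sp.
Variable R : rcfType.

Definition Jmx n : 'M[R]_(n + n) := block_mx 0 1%:M (- 1%:M) 0.

Definition sp n (S : 'M[R]_(n + n)) : Prop := preserves (Jmx n) S.

Lemma mul_Jmx n : Jmx n *m Jmx n = - 1%:M.
Proof.
rewrite /Jmx mulmx_block !mulmx0 !mul0mx !addr0 !add0r mulmx1 mul1mx.
by rewrite (scalar_mx_block n n) opp_block_mx !oppr0.
Qed.

Lemma Jmx_unit n : Jmx n \in unitmx.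
Proof.
have /mulmx1_unit[] // : Jmx n *m (- Jmx n) = 1%:M.
by rewrite mulmxN mul_Jmx opprK.
Qed.

Lemma sp1 n : sp (1%:M : 'M[R]_(n + n)).
Proof. by rewrite /sp /preserves /preserves mul1mx trmx1 mulmx1. Qed.

Lemma sp_unit n (S : 'M[R]_(n + n)) : sp S -> S \in unitmx.
Proof. by move=> hS; exact: (preserves_unit (Jmx_unit n) hS). Qed.

Lemma sp_block_diag n (L K : 'M[R]_n) :
  L *m K^T = 1%:M -> sp (block_mx L 0 0 K).
Proof.
move=> LK; have KL : K *m L^T = 1%:M by rewrite -[RHS]trmx1 -LK trmx_mul trmxK.
rewrite /sp /preserves /Jmx tr_block_mx !mulmx_block !trmx0 !(mulmx0, mul0mx,
  addr0, add0r).
by rewrite mulmx1 LK mulmxN mulmx1 mulNmx KL.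
Qed.

Definition posdefmx n (G : 'M[R]_n) :=
  forall v : 'rV[R]_n, v != 0 -> 0 < (v *m G *m v^T) 0 0.

Lemma posdefmx_congr n (G S : 'M[R]_n) :
  S \in unitmx -> posdefmx G -> posdefmx (S *m G *m S^T).
Proof.
move=> uS G0 v v0; have := G0 (v *m S); rewrite trmx_mul !mulmxA; apply.
by apply: contraNneq v0 => /(congr1 (mulmxr (invmx S))) /=;
  rewrite mulmxK // mul0mx => ->.
Qed.

Lemma posdefmx_ul n (A B C D : 'M[R]_n) :
  posdefmx (block_mx A B C D) -> posdefmx A.
Proof.
move=> G0 v v0; have := G0 (row_mx v 0).
rewrite mul_row_block !mul0mx !addr0 tr_row_mx mul_row_col trmx0 mulmx0 addr0.
by apply; apply: contraNneq v0 => /(congr1 lsubmx);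
  rewrite row_mxKl linear0 => ->.
Qed.

Lemma posdefmx_dr n (A B C D : 'M[R]_n) :
  posdefmx (block_mx A B C D) -> posdefmx D.
Proof.
move=> G0 v v0; have := G0 (row_mx 0 v).
rewrite mul_row_block !mul0mx !add0r tr_row_mx mul_row_col trmx0 mulmx0 add0r.
by apply; apply: contraNneq v0 => /(congr1 rsubmx);
  rewrite row_mxKr linear0 => ->.
Qed.

Lemma posdefmx_mx2 (a x b : R) :
  posdefmx (mx2 a x x b) -> [/\ 0 < a, 0 < b & x ^+ 2 < a * b].
Proof.
move=> G0.
have E (u v : R) : (u != 0) || (v != 0) ->
    0 < u ^+ 2 * a + u * v * x *+ 2 + v ^+ 2 * b.
  move=> uv; pose w : 'rV[R]_2 := \row_j if j == 0 then u else v.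
  have -> : u ^+ 2 * a + u * v * x *+ 2 + v ^+ 2 * b
            = (w *m mx2 a x x b *m w^T) 0 0.
    by rewrite !mxE !big_ord_recl !big_ord0 !mxE !big_ord_recl !big_ord0 !mxE
      /=; ring.
  apply: G0; apply: contraL uv => /eqP/rowP e.
  by move: (e 0) (e 1); rewrite !mxE /= => -> ->; rewrite eqxx.
have a0 : 0 < a by have := E 1 0; rewrite oner_eq0 => /(_ isT); lra.
have b0 : 0 < b by have := E 0 1; rewrite oner_eq0 orbT => /(_ isT); lra.
split=> //; have := E x (- a); rewrite oppr_eq0 (gt_eqF a0) orbT => /(_ isT).
have -> : x ^+ 2 * a + x * - a * x *+ 2 + (- a) ^+ 2 * b = a * (a * b - x ^+ 2).
  by ring.
by rewrite pmulr_rgt0 // subr_gt0.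
Qed.

(** Singular value decomposition of X = [[x11, x12], [x21, x22]] by rotations. The right one
    diagonalises X^T X, so the rotated columns y and z are orthogonal; the left one is aligned with
    y. *)
Lemma svd2_rot (x11 x12 x21 x22 : R) : exists c1 s1 c2 s2,
  [/\ c1 ^+ 2 + s1 ^+ 2 = 1, c2 ^+ 2 + s2 ^+ 2 = 1,
      c1 * (x12 * c2 - x11 * s2) + s1 * (x22 * c2 - x21 * s2) = 0
    & c1 * (x21 * c2 + x22 * s2) - s1 * (x11 * c2 + x12 * s2) = 0].
Proof.
have [c2 [s2 [cs2 ort _]]] := sym2_diag_rot (x11 ^+ 2 + x21 ^+ 2)
   (x11 * x12 + x21 * x22) (x12 ^+ 2 + x22 ^+ 2).
pose y1 := x11 * c2 + x12 * s2; pose y2 := x21 * c2 + x22 * s2.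
pose z1 := x12 * c2 - x11 * s2; pose z2 := x22 * c2 - x21 * s2.
have yz : y1 * z1 + y2 * z2 = 0 by rewrite -ort /y1 /y2 /z1 /z2; ring.
have unit_vec (u v : R) : exists c s,
  [/\ c ^+ 2 + s ^+ 2 = 1, c * v - s * u = 0 &
    (u, v) != 0 -> exists k, c = k * u /\ s = k * v].
  have [/eqP|uv0] := eqVneq (u, v) 0.
    rewrite xpair_eqE => /andP[/eqP-> /eqP->]; exists 1, 0.
    by split=> //; first [ring | rewrite eqxx].
  pose N := Num.sqrt (u ^+ 2 + v ^+ 2).
  have uv_gt0 : 0 < u ^+ 2 + v ^+ 2.
    rewrite lt0r addr_ge0 ?sqr_ge0 // andbT paddr_eq0 ?sqr_ge0 //.
    by rewrite !expf_eq0 /=; apply: contraNN uv0 => /andP[/eqP-> /eqP->].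
  have N0 : N != 0 by rewrite gt_eqF // sqrtr_gt0.
  have N2 : u ^+ 2 + v ^+ 2 = N ^+ 2 by rewrite sqr_sqrtr ?ltW.
  exists (u / N), (v / N); split.
  - have -> : (u / N) ^+ 2 + (v / N) ^+ 2 = (u ^+ 2 + v ^+ 2) / N ^+ 2 by field.
    by rewrite N2 mulfV // expf_neq0.
  - by field.
  - by move=> _; exists N^-1; split; rewrite mulrC.
have [[y10 y20]|y0] := eqVneq (y1, y2) 0; last first.
  have [c1 [s1 [cs1 e /(_ y0)[k [c1E s1E]]]]] := unit_vec y1 y2.
  exists c1, s1, c2, s2; split=> //; rewrite -/y1 -/y2 -/z1 -/z2 // c1E s1E.
  by rewrite -!mulrA -mulrDr yz mulr0.
(* When y = 0 only orthogonality to z remains to be arranged. *)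
have [c1 [s1 [cs1 e _]]] := unit_vec z2 (- z1).
exists c1, s1, c2, s2; split=> //; rewrite -/y1 -/y2 -/z1 -/z2.
  by rewrite -[RHS]oppr0 -e; ring.
by rewrite y10 y20 !mulr0 subr0.
Qed.

Lemma ler_of_sqr (u v : R) : 0 <= v -> u ^+ 2 <= v ^+ 2 -> u <= v.
Proof. move=> v0; case: (leP u v) => // uv; nra. Qed.

(* Two-mode covariance matrix in the ordering (x_1, x_2, p_1, p_2), with local
   blocks a 1 and b 1 and correlation block (x_ij) between the modes. *)
Definition two_mode_normal (a b x11 x12 x21 x22 : R) : 'M[R]_(2 + 2) :=
  block_mx (mx2 a x11 x11 b) (mx2 0 x12 x21 0)
           (mx2 0 x21 x12 0) (mx2 a x22 x22 b).

(** By the invariants, (p + q)^2 <= (a + b)^2 amounts to p q <= a b - x y, and (q - p)^2 >= (a -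
    b)^2 to p q <= a b + x y. If p = a and q = b, the product invariant forces x = y = 0, so the
    correlations vanish. *)
Lemma two_mode_step (a b x11 x12 x21 x22 : R) :
  posdefmx (two_mode_normal a b x11 x12 x21 x22) ->
  exists T p q,
    [/\ sp T,
        T *m two_mode_normal a b x11 x12 x21 x22 *m T^T
          = two_mode_normal p q 0 0 0 0,
        [/\ p <= a, p <= b & p + q <= a + b],
        a - b <= q - p /\ b - a <= q - p
      & p = a -> q = b -> [/\ x11 = 0, x12 = 0, x21 = 0 & x22 = 0]].
Proof.
move=> G0.
have [c1 [s1 [c2 [s2 [cs1 cs2 o12 o21]]]]] := svd2_rot x11 x12 x21 x22.
pose x := c1 * (x11 * c2 + x12 * s2) + s1 * (x21 * c2 + x22 * s2).
pose y := c1 * (x22 * c2 - x21 * s2) - s1 * (x12 * c2 - x11 * s2).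
pose C := mx2 c1 0 0 c2; pose S := mx2 s1 0 0 s2.
(* [O] rotates each mode within its own (x, p) plane, which leaves the local blocks a 1 and b 1
   unchanged. *)
pose O := block_mx C S (- S) C.
have spO : sp O.
  rewrite /sp /preserves /O /Jmx tr_block_mx !mulmx_block raddfN /=.
  rewrite mx2_1 mx2_0 /C /S !(mx2_tr, mx2N, mx2_mul, mx2D).
  congr block_mx; congr mx2;
  first [ring | rewrite -[in RHS]cs1; ring | rewrite -[in RHS]cs2; ring].
have OG : O *m two_mode_normal a b x11 x12 x21 x22 *m O^T
          = block_mx (mx2 a x x b) 0 0 (mx2 a y y b).
  rewrite /O /two_mode_normal tr_block_mx !mulmx_block raddfN /=.
  rewrite mx2_0 /C /S !(mx2_tr, mx2N, mx2_mul, mx2D).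
  have e1 : a = a * (c1 ^+ 2 + s1 ^+ 2) by rewrite cs1 mulr1.
  have e2 : b = b * (c2 ^+ 2 + s2 ^+ 2) by rewrite cs2 mulr1.
  congr block_mx; congr mx2; rewrite /x /y;
  first [ring | rewrite [RHS]e1; ring | rewrite [RHS]e2; ring
    | rewrite -[RHS]o12; ring | rewrite -[RHS]o21; ring
    | rewrite -[RHS]oppr0 -[in RHS]o12; ring
    | rewrite -[RHS]oppr0 -[in RHS]o21; ring].
(* Rotations preserve the sum of squares of the correlation block, so x = y = 0 kills all four
   entries. *)
have xx : x ^+ 2 + y ^+ 2 = x11 ^+ 2 + x12 ^+ 2 + x21 ^+ 2 + x22 ^+ 2.
  have -> : x ^+ 2 + y ^+ 2 = (c1 ^+ 2 + s1 ^+ 2) * (c2 ^+ 2 + s2 ^+ 2)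
     * (x11 ^+ 2 + x12 ^+ 2 + x21 ^+ 2 + x22 ^+ 2)
     - (c1 * (x12 * c2 - x11 * s2) + s1 * (x22 * c2 - x21 * s2)) ^+ 2
     - (c1 * (x21 * c2 + x22 * s2) - s1 * (x11 * c2 + x12 * s2)) ^+ 2.
    by rewrite /x /y; ring.
  by rewrite cs1 cs2 o12 o21 !expr0n !subr0 !mul1r.
have := posdefmx_congr (sp_unit spO) G0; rewrite OG => G1.
have [a0 b0 xab] := posdefmx_mx2 (posdefmx_ul G1).
have [_ _ yab] := posdefmx_mx2 (posdefmx_dr G1).
have [L [K [p [q [LK LA KB /andP[p0 pq] [sumE prodE]]]]]] :=
  two_mode_williamson a0 b0 xab yab.
have q0 : 0 < q by apply: lt_le_trans pq.
(* Both follow from (a b - x^2) (a b - y^2) = (a b - x y)^2 - a b (x - y)^2 and its analogue with y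
   replaced by -y. *)
have xyab : p * q <= a * b - x * y /\ p * q <= a * b + x * y.
  have sq : (p * q) ^+ 2 = (a * b - x ^+ 2) * (a * b - y ^+ 2).
    by rewrite exprMn prodE.
  have ab0 : 0 < a * b by rewrite mulr_gt0.
  have xy2 : (x * y) ^+ 2 <= (a * b) ^+ 2.
    by rewrite exprMn (expr2 (a * b)) ler_pM ?sqr_ge0 ?ltW.
  have xy_le : x * y <= a * b by apply: ler_of_sqr => //; exact: ltW.
  have xy_ge : - (x * y) <= a * b by apply: ler_of_sqr; rewrite ?sqrrN // ltW.
  split; apply: ler_of_sqr; rewrite ?sq; try lra.
  - have := mulr_ge0 (ltW ab0) (sqr_ge0 (x - y)); nra.
  - have := mulr_ge0 (ltW ab0) (sqr_ge0 (x + y)); nra.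
have [pq1 pq2] := xyab.
have sum_le : p + q <= a + b by apply: ler_of_sqr; [lra | nra].
have d1 : a - b <= q - p by apply: ler_of_sqr; [lra | nra].
have d2 : b - a <= q - p by apply: ler_of_sqr; [lra | nra].
exists (block_mx L 0 0 K *m O), p, q; split.
- by apply: preserves_mul => //; apply: sp_block_diag.
- rewrite trmx_mul !mulmxA -(mulmxA _ O) -(mulmxA _ _ O^T) OG.
  rewrite tr_block_mx !mulmx_block !trmx0 !(mulmx0, mul0mx, addr0, add0r) LA KB.
  by rewrite /two_mode_normal mx2_0.
- by split; lra.
- by [].
move=> pa qb; move: prodE; rewrite pa qb => prodE.
have : x ^+ 2 + y ^+ 2 = 0.
  have := sqr_ge0 x; have := sqr_ge0 y; have := mulr_gt0 a0 b0.
  move: prodE xab yab; rewrite -exprMn; move: (a * b) (x ^+ 2) (y ^+ 2).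
  move=> m u v; nra.
rewrite xx; have := sqr_ge0 x11; have := sqr_ge0 x12; have := sqr_ge0 x21.
have := sqr_ge0 x22 => h1 h2 h3 h4 e.
by split; apply/eqP; rewrite -sqrf_eq0; apply/eqP; lra.
Qed.

End Sp.

(** * Two-mode states with prescribed local spectra *)

Section TwoModeRealization.
Variable R : rcfType.

(* x and y are recovered from the invariants x y and x^2 + y^2. *)
Lemma two_mode_realize (p q a b : R) :
    0 < p -> p <= q -> 0 < a -> 0 < b ->
    p + q <= a + b -> a - b <= q - p -> b - a <= q - p ->
  exists T x y, sp T /\
    T *m two_mode_normal p q 0 0 0 0 *m T^T = two_mode_normal a b x 0 0 y.
Proof.
move=> p0 pq a0 b0 sum_le d1 d2.
have q0 : 0 < q by apply: lt_le_trans pq.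
have ab0 : 0 < a * b by rewrite mulr_gt0.
have pq0 : 0 < p * q by rewrite mulr_gt0.
have abn0 : a * b != 0 by rewrite gt_eqF.
(* The invariants force x y = [P] and x^2 + y^2 = [Q]. Then (x + y)^2 = Q + 2 P and (x - y)^2 = Q -
   2 P, so real solutions require these two to be nonnegative. *)
pose P := (p ^+ 2 + q ^+ 2 - a ^+ 2 - b ^+ 2) / 2.
pose Q := ((a * b) ^+ 2 + P ^+ 2 - (p * q) ^+ 2) / (a * b).
have P1 : p * q <= a * b - P.
  have -> : a * b - P = p * q + ((a + b) ^+ 2 - (p + q) ^+ 2) / 2.
    by rewrite /P; field.
  rewrite lerDl divr_ge0 // subr_ge0 lerXn2r ?nnegrE; lra.
have P2 : p * q <= a * b + P.
  have -> : a * b + P = p * q + ((q - p) ^+ 2 - (a - b) ^+ 2) / 2.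
    by rewrite /P; field.
  rewrite lerDl divr_ge0 // subr_ge0.
  by case: (leP b a) => h; [|rewrite -sqrrN]; rewrite lerXn2r ?nnegrE; lra.
have Qm : 0 <= Q - P *+ 2.
  have -> : Q - P *+ 2 = ((a * b - P) ^+ 2 - (p * q) ^+ 2) / (a * b).
    by rewrite /Q; field; rewrite !gt_eqF.
  by rewrite divr_ge0 ?(ltW ab0) // subr_ge0 lerXn2r ?nnegrE; lra.
have Qp : 0 <= Q + P *+ 2.
  have -> : Q + P *+ 2 = ((a * b + P) ^+ 2 - (p * q) ^+ 2) / (a * b).
    by rewrite /Q; field; rewrite !gt_eqF.
  by rewrite divr_ge0 ?(ltW ab0) // subr_ge0 lerXn2r ?nnegrE; lra.
pose u := Num.sqrt (Q + P *+ 2); pose v := Num.sqrt (Q - P *+ 2).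
have u2 : u ^+ 2 = Q + P *+ 2 by rewrite sqr_sqrtr.
have v2 : v ^+ 2 = Q - P *+ 2 by rewrite sqr_sqrtr.
pose x := (u + v) / 2; pose y := (u - v) / 2.
have xy : x * y = P.
  have -> : x * y = (u ^+ 2 - v ^+ 2) / 4 by rewrite /x /y; field.
  by rewrite u2 v2; field.
have xxyy : x ^+ 2 + y ^+ 2 = Q.
  have -> : x ^+ 2 + y ^+ 2 = (u ^+ 2 + v ^+ 2) / 2 by rewrite /x /y; field.
  by rewrite u2 v2; field.
have det : (a * b - x ^+ 2) * (a * b - y ^+ 2) = (p * q) ^+ 2.
  have -> : (a * b - x ^+ 2) * (a * b - y ^+ 2)
    = (a * b) ^+ 2 - a * b * (x ^+ 2 + y ^+ 2) + (x * y) ^+ 2 by ring.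
  by rewrite xxyy xy /Q; field; rewrite !gt_eqF.
have det0 : 0 < (a * b - x ^+ 2) * (a * b - y ^+ 2) by rewrite det exprn_gt0.
have xab : x ^+ 2 < a * b.
  (* The two factors of [det0] have the same sign. Were both negative, (x y)^2 would exceed (a b)^2,
     against [P1] and [P2]. *)
  rewrite ltNge; apply/negP => h.
  have h' : a * b < y ^+ 2 by nra.
  have : (a * b) ^+ 2 < (x * y) ^+ 2.
    rewrite exprMn expr2; apply: le_lt_trans (_ : x ^+ 2 * (a * b) < _); nra.
  by rewrite xy ltNge => /negP; apply; rewrite -subr_ge0 subr_sqr mulr_ge0; lra.
have yab : y ^+ 2 < a * b by nra.
(* The normal form of the matrix just built has the same p^2 + q^2 and p q, hence equals diag(p, q);
   inverting its transformation gives [T]. *)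
have [L [K [p' [q' [LK LA KB /andP[p'0 pq'] [sumE prodE]]]]]] :=
  two_mode_williamson a0 b0 xab yab.
have pq'0 : 0 < p' * q' by rewrite mulr_gt0 // (lt_le_trans p'0).
have sqE : (p' * q') ^+ 2 = (p * q) ^+ 2 by rewrite -det -prodE exprMn.
have prodE' : p' * q' = p * q.
  by apply/le_anti/andP; split; apply: ler_of_sqr; try exact: ltW;
    rewrite sqE.
have sumE' : p' ^+ 2 + q' ^+ 2 = p ^+ 2 + q ^+ 2 by rewrite sumE xy /P; field.
have sumE2 : p' + q' = p + q.
  by apply/le_anti/andP; split; apply: ler_of_sqr; nra.
have pp' : p' = p.
  have : (q' - p') ^+ 2 = (q - p) ^+ 2.
    have E (s t : R) : (s - t) ^+ 2 = t ^+ 2 + s ^+ 2 - t * s *+ 2 by ring.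
    by rewrite !E sumE' prodE'.
  move=> e; have : q' - p' = q - p.
    by apply/le_anti/andP; split; apply: ler_of_sqr;
      rewrite ?e ?lexx // subr_ge0.
  lra.
have qq' : q' = q by lra.
pose U := block_mx L 0 0 K; have spU : sp U by apply: sp_block_diag.
exists (invmx U), x, y; split; first exact: (preserves_inv (Jmx_unit R _)).
have UG : U *m two_mode_normal a b x 0 0 y *m U^T = two_mode_normal p q 0 0 0 0.
  rewrite /U /two_mode_normal tr_block_mx -mx2_0 !mulmx_block.
  by rewrite !trmx0 !(mulmx0, mul0mx, addr0, add0r) LA KB pp' qq'.
rewrite -UG trmx_inv !mulmxA mulVmx ?sp_unit // mul1mx mulmxK //.
by rewrite unitmx_tr sp_unit.
Qed.

End TwoModeRealization.

(** * Symplectic maps acting on some of the modes *)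

Section Embed.
Variable R : rcfType.

Section Injection.
Variables (m n : nat) (f : 'I_m -> 'I_n).

Definition dbl_ord (i : 'I_(m + m)) : 'I_(n + n) :=
  match split i with inl k => lshift n (f k) | inr k => rshift n (f k) end.

Lemma dbl_ord_l k : dbl_ord (lshift m k) = lshift n (f k).
Proof. by rewrite /dbl_ord (unsplitK (inl k)). Qed.

Lemma dbl_ord_r k : dbl_ord (rshift m k) = rshift n (f k).
Proof. by rewrite /dbl_ord (unsplitK (inr k)). Qed.

Definition sel_mx : 'M[R]_(m + m, n + n) := rowsub dbl_ord 1%:M.

Lemma sel_mxE :
  sel_mx = block_mx (rowsub f 1%:M) 0 0 (rowsub f 1%:M).
Proof.
apply/matrixP => i j.
case: (split_ordP i) => i' ->; case: (split_ordP j) => j' ->;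
  rewrite ?block_mxEul ?block_mxEur ?block_mxEdl ?block_mxEdr !mxE
    ?dbl_ord_l ?dbl_ord_r ?eq_lshift ?eq_rshift ?eq_lrshift ?eq_rlshift //.
Qed.

Lemma mul_sel_mx p (A : 'M_(n + n, p)) : sel_mx *m A = rowsub dbl_ord A.
Proof. by rewrite mul_rowsub_mx mul1mx. Qed.

Lemma mul_mx_selT p (A : 'M_(p, n + n)) : A *m sel_mx^T = colsub dbl_ord A.
Proof. by rewrite trmx_mxsub trmx1 mulmx_colsub mulmx1. Qed.

Lemma sel_mx_J : sel_mx *m Jmx R n = Jmx R m *m sel_mx.
Proof.
rewrite sel_mxE /Jmx !mulmx_block !(mulmx0, mul0mx, addr0, add0r, mulmx1,
  mul1mx).
by rewrite mulmxN mulNmx mulmx1 mul1mx.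
Qed.

Hypothesis f_inj : injective f.

Lemma dbl_ord_inj : injective dbl_ord.
Proof.
move=> i j; case: (split_ordP i) => i' ->; case: (split_ordP j) => j' ->;
  rewrite ?dbl_ord_l ?dbl_ord_r.
- by move/lshift_inj/f_inj => ->.
- by move/eqP; rewrite eq_lrshift.
- by move/eqP; rewrite eq_rlshift.
- by move/rshift_inj/f_inj => ->.
Qed.

Lemma sel_mxK : sel_mx *m sel_mx^T = 1%:M.
Proof.
rewrite mul_sel_mx; apply/matrixP => i j; rewrite !mxE.
by rewrite eq_sym (inj_eq dbl_ord_inj).
Qed.

(** For injective [f], this acts as [T] on the modes in the image of [f] and as the identity on the
    others. *)
Definition embed (T : 'M[R]_(m + m)) : 'M[R]_(n + n) :=
  1%:M + sel_mx^T *m (T - 1%:M) *m sel_mx.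

(** With N = T - 1, the selection matrix F satisfies F F^T = 1 and intertwines the two forms J. The
    terms added to J are therefore F^T (N J N^T + N J + J N^T) F, whose bracket vanishes because [T]
    is symplectic. *)
Lemma sp_embed T : sp T -> sp (embed T).
Proof.
move=> spT; rewrite /sp /preserves /embed; set F := sel_mx; set N := T - 1%:M.
rewrite [(_ + _)^T]raddfD /= trmx1 !trmx_mul trmxK mulmxDl mul1mx mulmxDr
  mulmx1 mulmxDl.
have JF : Jmx R n *m F^T = F^T *m Jmx R m.
  have := congr1 trmx sel_mx_J; rewrite !trmx_mul.
  have trJ k : (Jmx R k)^T = - Jmx R k.
    by rewrite /Jmx tr_block_mx opp_block_mx !trmx0 !raddfN /= !trmx1 opprK
      oppr0.
  by rewrite !trJ mulmxN mulNmx => /oppr_inj ->.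
have -> : F^T *m N *m F *m Jmx R n = F^T *m (N *m Jmx R m) *m F.
  by rewrite -!mulmxA sel_mx_J.
have -> : Jmx R n *m (F^T *m (N^T *m F)) = F^T *m (Jmx R m *m N^T) *m F.
  by rewrite !mulmxA JF.
have -> : F^T *m (N *m Jmx R m) *m F *m (F^T *m (N^T *m F))
    = F^T *m (N *m Jmx R m *m N^T) *m F.
  by rewrite !mulmxA -(mulmxA _ F) sel_mxK mulmx1.
rewrite -addrA -[RHS]addr0; congr (_ + _).
rewrite addrA addrC -!mulmxDl -!mulmxDr.
suff -> : N *m Jmx R m *m N^T + (N *m Jmx R m + Jmx R m *m N^T) = 0.
  by rewrite mulmx0 mul0mx.
move: spT; rewrite /sp /preserves -[T](subrK 1%:M) -/N [(_ + _)^T]raddfD /=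
  trmx1.
rewrite mulmxDl mul1mx mulmxDr !mulmxDl !mulmx1 => e.
by apply: (addIr (Jmx R m)); rewrite add0r -[RHS]e addrA addrAC -!addrA.
Qed.

Lemma sel_mx_embed T : sel_mx *m embed T = T *m sel_mx.
Proof.
by rewrite mulmxDr mulmx1 !mulmxA sel_mxK mul1mx mulmxBl mul1mx addrC subrK.
Qed.

Lemma embed_congr_dbl T (G : 'M_(n + n)) :
  mxsub dbl_ord dbl_ord (embed T *m G *m (embed T)^T)
  = T *m mxsub dbl_ord dbl_ord G *m T^T.
Proof.
have E (H : 'M_(n + n)) : mxsub dbl_ord dbl_ord H = sel_mx *m H *m sel_mx^T.
  by rewrite mul_sel_mx mul_mx_selT; apply/matrixP => i j; rewrite !mxE.
rewrite !E !mulmxA sel_mx_embed -!mulmxA -trmx_mul sel_mx_embed trmx_mul.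
by rewrite !mulmxA.
Qed.

Lemma row_embed T a :
  (forall i, dbl_ord i != a) -> row a (embed T) = delta_mx 0 a.
Proof.
move=> a_nin; rewrite raddfD /= row1 !row_mul [row a sel_mx^T](_ : _ = 0).
  by rewrite !mul0mx addr0.
by apply/rowP => i; rewrite !mxE (negPf (a_nin i)).
Qed.

Lemma embed_congr_id T (G : 'M_(n + n)) a b :
    (forall i, dbl_ord i != a) -> (forall i, dbl_ord i != b) ->
  (embed T *m G *m (embed T)^T) a b = G a b.
Proof.
move=> ha hb.
have -> : (embed T *m G *m (embed T)^T) a b
  = (row a (embed T) *m G *m (row b (embed T))^T) 0 0.
  by rewrite -row_mul tr_row !mxE; apply: eq_bigr => j _; rewrite !mxE.
rewrite !row_embed // trmx_delta -rowE -colE !mxE //.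
Qed.

(** [T] only recombines the rows indexed by the image of [f], and these vanish in column [a]. *)
Lemma embed_congr_mixed T (G : 'M_(n + n)) a b i : (forall i, dbl_ord i != a) ->
   (forall j, G (dbl_ord j) a = 0) -> b = dbl_ord i ->
  (embed T *m G *m (embed T)^T) b a = 0.
Proof.
move=> ha hG ->.
have -> : (embed T *m G *m (embed T)^T) (dbl_ord i) a
  = (sel_mx *m embed T *m G *m (row a (embed T))^T) i 0.
  rewrite mul_sel_mx mul_rowsub_mx [LHS]mxE [RHS]mxE.
  by apply: eq_bigr => j _; rewrite !mxE.
rewrite row_embed // sel_mx_embed trmx_delta -!mulmxA -colE mul_sel_mx.
rewrite [rowsub _ _](_ : _ = 0) ?mulmx0 ?mxE //.
by apply/colP => j; rewrite !mxE hG.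
Qed.

End Injection.
End Embed.

(** * Sufficiency of the inequalities *)

Section Combinatorics.
Variable R : realFieldType.
Implicit Types c d : nat -> R.

Definition psum d n := \sum_(i < n) d i.

Lemma psum0 d : psum d 0 = 0. Proof. exact: big_ord0. Qed.

Lemma psumS d n : psum d n.+1 = psum d n + d n.
Proof. exact: big_ord_recr. Qed.

Lemma psum_shift d n : psum (fun j => d j.+1) n = psum d n.+1 - d 0%N.
Proof. by rewrite [psum d _]big_ord_recl addrC addKr. Qed.

Lemma le_psum c d n :
  (forall i, (i < n)%N -> d i <= c i) -> psum d n <= psum c n.
Proof. by move=> h; apply: ler_sum => i _; apply: h. Qed.

(** Here [n] is the last index, so there are n + 1 modes and [psum d n] omits the last value.
    Sequences live on nat so that the induction can shift and delete entries. *)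
Record spectra_cond n c d : Prop := SpectraCond {
  cond_c : forall i j, (i <= j <= n)%N -> c i <= c j;
  cond_d : forall i j, (i <= j <= n)%N -> d i <= d j;
  cond_psum : forall j, (j <= n.+1)%N -> psum d j <= psum c j;
  cond_last : c n - psum c n <= d n - psum d n }.

(** The spectrum left for the remaining modes once the pair [d k], [d k.+1] has been traded for
    [c 0] and [r]. *)
Definition merge_at d k r j : R :=
  if (j < k)%N then d j else if j == k then r else d j.+1.

Lemma psum_merge d k r n :
  psum (merge_at d k r) n =
  if (n <= k)%N then psum d n else psum d n.+1 - d k - d k.+1 + r.
Proof.
elim: n => [|n IHn]; first by rewrite !psum0.
rewrite psumS IHn /merge_at; case: (ltngtP n k) => [nk|kn|->].
- by rewrite psumS.
- by rewrite (psumS _ n.+1); ring.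
- by rewrite 2!psumS; ring.
Qed.

(* The smallest target c 0 is produced from two neighbouring values of d, and
   the second value r obtained with it is chosen so that the conditions persist
   for the remaining modes. *)
Lemma spectra_cond_split n c d : spectra_cond n.+1 c d ->
  exists k r, [/\ (k <= n)%N, d k + d k.+1 <= c 0%N + r,
    c 0%N - r <= d k.+1 - d k /\ r - c 0%N <= d k.+1 - d k
    & spectra_cond n (fun j => c j.+1) (merge_at d k r)].
Proof.
case=> hc hd hs hl.
have d0c0 : d 0%N <= c 0%N by have := hs 1%N isT; rewrite !psumS !psum0; lra.
have c0 i : (i <= n.+1)%N -> c 0%N <= c i by move=> h; apply: hc; lia.
(* While [d k <= c 0], the bound holds term by term, since each [d i] is at most [d k] and each
   [c i] at least [c 0]. *)
have term k : (k <= n.+1)%N -> d k <= c 0%N ->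
    forall j, (j <= k)%N -> (j <= n.+1)%N -> psum d j <= psum c j.+1 - c 0%N.
  move=> kn dk j jk jn; rewrite -psum_shift; apply: le_psum => i ij.
  apply: le_trans (_ : d k <= _); first by apply: hd; lia.
  by apply: le_trans dk _; apply: c0; lia.
case: (leP (d n) (c 0%N)) => [dn|dn].
- have t0 : d n <= d n.+1 by apply: hd; lia.
  have h1 := hs n.+2 (leqnn _); rewrite !psumS in h1.
  have h2 := hl; rewrite !psumS in h2.
  have h3 := term n (leqnSn _) dn n (leqnn _) (leqnSn _); rewrite psumS in h3.
  have h4 := c0 n.+1 (leqnn _).
  (* All values up to [d n] are at most [c 0], so the last pair is used. Lower bounds on r: [r1]
     from the sum, [r2] from the difference, [r3] from the last condition. Upper bounds come from
     the difference and the total sum. Every lower bound is below every upper one, so the maximum of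
     the lower ones works. *)
  pose r1 := d n + d n.+1 - c 0%N; pose r2 := c 0%N - (d n.+1 - d n).
  pose r3 := c n.+1 - (psum c n.+1 - c 0%N) + psum d n.
  have [r [r_ge1 r_ge2 r_ge3 [r_le1 r_le2]]] : exists r,
      [/\ r1 <= r, r2 <= r, r3 <= r & r <= c 0%N + (d n.+1 - d n) /\
        r <= psum c n.+1 + c n.+1 - c 0%N - psum d n].
    exists (Num.max (Num.max r1 r2) r3); rewrite !le_max !ge_max !lexx !orbT /=.
    rewrite /r1 /r2 /r3 psumS.
    by split=> //; split; (apply/andP; split; [apply/andP; split|]); lra.
  (* Keeps the merged sequence sorted: [r1] suffices if [c 0 <= d n.+1], and [r2] otherwise. *)
  have r_ge : d n <= r.
    by move: r_ge1 r_ge2; rewrite /r1 /r2; case: (leP (c 0%N) (d n.+1)); lra.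
  exists n, r; split=> //.
  + by move: r_ge1; rewrite /r1; lra.
  + by move: r_ge2; rewrite /r2; split; lra.
  split.
  + by move=> i j ij; apply: hc; move: ij; clear; lia.
  + move=> i j /andP[ij jn]; rewrite /merge_at.
    case: (ltnP j n) => jn'.
      by rewrite (leq_ltn_trans ij jn'); apply: hd; move: ij jn; clear; lia.
    have -> : j = n by move: jn jn'; clear; lia.
    rewrite eqxx; case: (ltngtP i n) => // ni; last by move: ij jn ni; clear;
      lia.
    by apply: le_trans (_ : d n <= _) => //; apply: hd; move: ni; clear; lia.
  + move=> j jn; rewrite psum_merge psum_shift; case: leqP => jn'.
      by apply: term dn _ _ _; move: jn'; clear; lia.
    have -> : j = n.+1 by move: jn jn'; clear; lia.
    by rewrite !psumS; move: r_le2; rewrite psumS; lra.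
  + rewrite psum_merge leqnn /merge_at ltnn eqxx psum_shift.
    by move: r_ge3; rewrite /r3; lra.
(* Otherwise [c 0] falls between two neighbours with k < n, and the last value of d stays in
   place. *)
have [k /andP[kn /andP[dk dk1]]] :
    exists k, (k < n)%N && (d k <= c 0%N < d k.+1).
  elim: n dn {hc hd hs hl c0 term} => [|n IHn] dn; first by lra.
  case: (ltP (c 0%N) (d n)) => h; last by exists n; rewrite ltnSn h.
  by have [k /andP[kn hk]] := IHn h; exists k; rewrite hk ltnW.
(* Preserving the sum of the pair lets the partial sums beyond k and the last condition carry over
   unchanged. *)
have [r rE] : exists r, r = d k + d k.+1 - c 0%N by eexists.
exists k, r; split; [exact: ltnW | lra | by split; lra |].
split.
- by move=> i j ij; apply: hc; move: ij; clear; lia.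
- have r1 : d k <= r by lra.
  have r2 : r <= d k.+1 by lra.
  move=> i j /andP[ij jn]; rewrite /merge_at.
  case: (ltngtP i k) => ik; case: (ltngtP j k) => jk;
    rewrite ?lexx //; try (by apply: hd; move: ij ik jk jn kn; clear; lia);
    try (by move: ij ik jk; clear; lia).
  + by apply: le_trans (_ : d k <= _) => //; apply: hd; move: ik kn; clear; lia.
  + by apply: le_trans r2 _; apply: hd; move: jk jn; clear; lia.
- move=> j jn; rewrite psum_merge psum_shift; case: leqP => jk.
    by apply: (term k) => //; move: jk kn; clear; lia.
  by have := hs j.+1 jn; lra.
rewrite psum_merge psum_shift leqNgt kn /= /merge_at ltnNge ltnW //= gtn_eqF //.
by have := hl; lra.
Qed.

End Combinatorics.

(** * Realising the local spectra by induction on the number of modes *)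

Section Sufficiency.
Variable R : rcfType.

Definition dbl_diag n (d : 'I_n -> R) : 'M[R]_(n + n) :=
  diag_mx (row_mx (\row_j d j) (\row_j d j)).

Lemma dbl_diag_dbl_ord m n (f : 'I_m -> 'I_n) (d : 'I_n -> R) : injective f ->
  mxsub (dbl_ord f) (dbl_ord f) (dbl_diag d) = dbl_diag (fun j => d (f j)).
Proof.
move=> f_inj; apply/matrixP => i j; rewrite mxE /dbl_diag mxE [RHS]mxE (inj_eq
  (dbl_ord_inj f_inj)).
congr (_ *+ _); case: (split_ordP i) => k ->.
  by rewrite dbl_ord_l !row_mxEl !mxE.
by rewrite dbl_ord_r !row_mxEr !mxE.
Qed.

(** [p] is [true] for the momentum and [false] for the position of mode [j]. *)
Definition phase_ord n (p : bool) (j : 'I_n) : 'I_(n + n) :=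
  if p then rshift n j else lshift n j.

Lemma phase_ordP n (i : 'I_(n + n)) : exists p j, i = phase_ord p j.
Proof.
by case: (split_ordP i) => j ->; [exists false, j | exists true, j].
Qed.

Lemma eq_phase_ord n p p' (j j' : 'I_n) :
  (phase_ord p j == phase_ord p' j') = (p == p') && (j == j').
Proof.
by case: p; case: p'; rewrite /= ?eq_lshift ?eq_rshift ?eq_lrshift ?eq_rlshift.
Qed.

Lemma dbl_phase_ord m n (f : 'I_m -> 'I_n) p j :
  dbl_ord f (phase_ord p j) = phase_ord p (f j).
Proof. by case: p; rewrite /= ?dbl_ord_l ?dbl_ord_r. Qed.

Lemma dbl_diagE n (d : 'I_n -> R) p p' j j' :
  dbl_diag d (phase_ord p j) (phase_ord p' j')
  = d j *+ ((p == p') && (j == j')).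
Proof.
by rewrite /dbl_diag mxE eq_phase_ord; case: p => /=;
  rewrite ?row_mxEl ?row_mxEr mxE.
Qed.

Definition normal_mode n (G : 'M[R]_(n + n)) (j : 'I_n) (c : R) : Prop :=
  forall p p', G (phase_ord p j) (phase_ord p' j) = c *+ (p == p').

Lemma dbl_diag2 (p q : R) :
  dbl_diag (fun j : 'I_2 => if j == 0 then p else q)
    = two_mode_normal p q 0 0 0 0.
Proof.
rewrite /dbl_diag diag_mx_row /two_mode_normal -mx2_0.
by congr block_mx; apply: mx2P; rewrite mx2E !mxE.
Qed.

Definition pair_ord n (i k : 'I_n) (t : 'I_2) := if t == 0 then i else k.

Lemma pair_ord_inj n (i k : 'I_n) : i != k -> injective (pair_ord i k).
Proof.
move=> ik [[|[|//]] s] [[|[|//]] t]; rewrite /pair_ord /= => e;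
  apply: val_inj => //=.
- by rewrite e eqxx in ik.
- by rewrite e eqxx in ik.
Qed.

Lemma dbl_ord_neq m n (f : 'I_m -> 'I_n) p (j : 'I_n) :
  (forall t, f t != j) -> forall i, dbl_ord f i != phase_ord p j.
Proof.
move=> fj i; have [p' [t ->]] := phase_ordP i.
by rewrite dbl_phase_ord eq_phase_ord negb_and fj orbT.
Qed.

(** A correlated pair yields [c 0] and r; without the mode carrying [c 0] the covariance is again
    diagonal, with spectrum [merge_at d k r], and the induction applies to it. The injection [s]
    records which mode receives which value. *)
Lemma realize_spectra n c d : spectra_cond n c d -> 0 < d 0%N ->
  exists (S : 'M[R]_(n.+1 + n.+1)) (s : 'I_n.+1 -> 'I_n.+1),
    [/\ sp S, injective s & forall j : 'I_n.+1,
      normal_mode (S *m dbl_diag (fun j : 'I_n.+1 => d j) *m S^T) (s j) (c j)].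
Proof.
elim: n c d => [|n IHn] c d cd d0.
  have e : d 0%N = c 0%N.
    case: cd => _ _ /(_ 1%N isT); rewrite !psumS !psum0 => h1 h2.
    by apply/le_anti; rewrite -[d _]add0r -[c _]add0r h1; move: h2;
      rewrite !subr0 !add0r.
  exists 1%:M, id; split; [exact: sp1 | by [] |].
  by move=> j p p'; rewrite trmx1 mulmx1 mul1mx dbl_diagE eqxx andbT ord1 e.
have [k [r [kn sum_le [d1 d2] cd']]] := spectra_cond_split cd.
have dk0 : 0 < d k by apply: lt_le_trans d0 _; apply: (cond_d cd); lia.
have dk1 : d k <= d k.+1 by apply: (cond_d cd); lia.
have c0 : 0 < c 0%N.
  by apply: lt_le_trans d0 _; have := cond_psum cd (j := 1) isT;
    rewrite !psumS !psum0 !add0r.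
have r0 : 0 < r by lra.
have [T [x [y [spT TE]]]] := two_mode_realize dk0 dk1 c0 r0 sum_le d1 d2.
have kP : (k < n.+2)%N by lia.
have k1P : (k.+1 < n.+2)%N by lia.
pose k0 := Ordinal kP; pose k1 := Ordinal k1P.
have k01 : k0 != k1 by rewrite -val_eqE /= neq_ltn ltnSn.
pose f := pair_ord k0 k1; have f_inj : injective f := pair_ord_inj k01.
pose D := dbl_diag (fun j : 'I_n.+2 => d j).
pose U := embed f T; pose G := U *m D *m U^T.
have GT : G^T = G by rewrite /G !trmx_mul trmxK tr_diag_mx mulmxA.
have Gf : mxsub (dbl_ord f) (dbl_ord f) G = two_mode_normal (c 0%N) r x 0 0 y.
  rewrite embed_congr_dbl // -TE; congr (_ *m _ *m _).
  rewrite dbl_diag_dbl_ord // -dbl_diag2; congr dbl_diag; apply: funext => j.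
  by rewrite /f /pair_ord; case: eqP.
have Ge p t p' t' : G (phase_ord p (f t)) (phase_ord p' (f t'))
    = two_mode_normal (c 0%N) r x 0 0 y (phase_ord p t) (phase_ord p' t').
  by rewrite -Gf [RHS]mxE !dbl_phase_ord.
(* [h] enumerates every mode except [k0], which already carries [c 0]; position k becomes the
   partner [k1], carrying r. *)
pose h := lift k0; have h_inj : injective h by apply: lift_inj.
have h_k (j : 'I_n.+1) : j = k :> nat -> h j = f 1.
  by move=> jk; apply: val_inj; rewrite /= /bump jk leqnn.
have h_nk (j : 'I_n.+1) : (j : nat) != k -> forall t, f t != h j.
  move=> jk t; rewrite /f /pair_ord; case: (t == 0); rewrite -val_eqE /= /bump.
    by move: jk; case: leqP; clear; lia.
  by move: jk; case: leqP; clear; lia.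
have Gh : mxsub (dbl_ord h) (dbl_ord h) G
    = dbl_diag (fun j : 'I_n.+1 => merge_at d k r j).
  apply/matrixP => i j; rewrite mxE.
  have [p [i' ->]] := phase_ordP i; have [p' [j' ->]] := phase_ordP j.
  rewrite !dbl_phase_ord dbl_diagE.
  have hm (l : 'I_n.+1) : (l : nat) != k -> merge_at d k r l = d (h l).
    move=> lk; rewrite /merge_at (negPf lk) /= /bump;
      case: ltngtP lk => // lk _.
  (* The partner [k1] is uncorrelated with every mode outside the pair. *)
  have off (l l' : 'I_n.+1) q q' : (l : nat) != k -> l' = k :> nat ->
      G (phase_ord q' (h l')) (phase_ord q (h l)) = 0.
    move=> lk l'k; apply: (@embed_congr_mixed _ _ _ f f_inj T D _ _ (phase_ord
      q' 1)).
    - by apply: dbl_ord_neq; apply: h_nk.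
    - move=> j0; have [p0 [t ->]] := phase_ordP j0.
      by rewrite dbl_phase_ord dbl_diagE (negPf (h_nk _ lk t)) andbF.
    - by rewrite dbl_phase_ord h_k.
  have [ik|ik] := eqVneq (i' : nat) k; have [jk|jk] := eqVneq (j' : nat) k.
  - have -> : j' = i' by apply: ord_inj; rewrite ik jk.
    rewrite h_k // Ge eqxx andbT /merge_at ik ltnn eqxx.
    by case: p p' => -[]; rewrite /= ?block_mxEul ?block_mxEdr ?block_mxEur
      ?block_mxEdl mx2E.
  - have /negPf-> : i' != j' by apply: contraNneq jk => <-; rewrite ik.
    by rewrite off // andbF.
  - have /negPf-> : i' != j' by apply: contraNneq ik => ->; rewrite jk.
    by rewrite -GT mxE off // andbF.
  - rewrite embed_congr_id ?hm //; try by apply: dbl_ord_neq; apply: h_nk.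
    by rewrite dbl_diagE (inj_eq h_inj).
have d''0 : 0 < merge_at d k r 0.
  rewrite /merge_at; case: (posnP k) => [->|//]; by rewrite eqxx.
have [S [s [spS s_inj hS]]] := IHn _ _ cd' d''0.
(* [c 0] sits on [k0]; the other values are placed by the induction hypothesis, transported along
   [h]. *)
exists (embed h S *m U), (fun j => if unlift ord0 j is Some j' then h (s j')
  else k0).
have GE : embed h S *m U *m D *m (embed h S *m U)^T
  = embed h S *m G *m (embed h S)^T.
  by rewrite trmx_mul /G !mulmxA.
split; first by apply: preserves_mul; [apply: sp_embed | apply: sp_embed].
  move=> i j; case: unliftP => [i'|] ->; case: unliftP => [j'|] -> //.
  - by move/h_inj/s_inj => ->.
  - by move/eqP; rewrite eq_sym (negPf (neq_lift _ _)).
  - by move/eqP; rewrite (negPf (neq_lift _ _)).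
move=> j p p'; rewrite GE; case: unliftP => [j'|] ->.
  rewrite -!(dbl_phase_ord h).
  by rewrite [LHS](_ : _ = mxsub (dbl_ord h) (dbl_ord h)
    (embed h S *m G *m (embed h S)^T) (phase_ord p (s j'))
      (phase_ord p' (s j')));
    [rewrite embed_congr_dbl // Gh hS | rewrite [RHS]mxE].
rewrite embed_congr_id; last 2 first.
- by apply: dbl_ord_neq => t; rewrite eq_sym neq_lift.
- by apply: dbl_ord_neq => t; rewrite eq_sym neq_lift.
rewrite [k0](_ : _ = f 0) // Ge.
by case: p p' => -[]; rewrite /= ?block_mxEul ?block_mxEdr ?block_mxEur
  ?block_mxEdl mx2E.
Qed.

(** Relabelling the modes by [s] acts alike on positions and momenta, hence is symplectic. *)
Lemma spectra_cond_sufficient n c d : spectra_cond n c d -> 0 < d 0%N ->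
  exists S : 'M[R]_(n.+1 + n.+1), sp S /\ forall j : 'I_n.+1,
    normal_mode (S *m dbl_diag (fun j : 'I_n.+1 => d j) *m S^T) j (c j).
Proof.
move=> cd d0; have [S [s [spS s_inj hS]]] := realize_spectra cd d0.
exists (sel_mx R s *m S); split.
  apply: preserves_mul => //; rewrite /sp /preserves sel_mx_J -mulmxA sel_mxK
    //; exact: mulmx1.
move=> j p p'; rewrite -hS -!(dbl_phase_ord s) trmx_mul !mulmxA.
by rewrite mul_mx_selT -!mulmxA mul_sel_mx !mulmxA mxE [LHS]mxE.
Qed.

End Sufficiency.

(** * Necessity of the inequalities *)

Section Compactness.
Local Open Scope classical_set_scope.
Variable R : realType.

Lemma continuous_vec_mx m n : continuous (@vec_mx R m n).
Proof.
move=> u s /nbhs_ballP[e e0 es]; apply/nbhs_ballP; exists e => // w [_ uw].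
by apply: es; split=> // i j; rewrite !mxE; apply: uw.
Qed.

(** Matrices are flattened to row vectors, where closed bounded sets are compact and [EVT_min_rV]
    applies. *)
Lemma matrix_EVT_min m n (A : set 'M[R]_(m, n)) (f : 'M[R]_(m, n) -> R)
    (M : R) :
    A !=set0 -> closed A -> (forall S, A S -> forall i j, `|S i j| <= M) ->
    continuous f ->
  exists2 S, A S & forall S', A S' -> f S <= f S'.
Proof.
move=> [S0 AS0] clA bdA cf.
pose B := @vec_mx R m n @^-1` A.
have clB : closed B by apply: preimage_closed => // u _;
  apply: continuous_vec_mx.
have M_ge0 : 0 <= Num.max 0 M by rewrite le_max lexx.
have bdB : bounded_set B.
  exists (Num.max 0 M); split; first exact: num_real.
  move=> x Mx u Bu; apply: le_trans (ltW Mx).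
  rewrite [leLHS]/Num.Def.normr /= mx_normrE; apply/bigmax_leP;
    split=> // -[i k] _ /=.
  rewrite ord1; case/mxvec_indexP: k => a b.
  have -> : u 0 (mxvec_index a b) = vec_mx u a b by rewrite mxE.
  by rewrite le_max (bdA _ Bu) orbT.
have [||u] := @EVT_min_rV R (m * n) (f \o vec_mx) B _ (bounded_closed_compact
  bdB clB).
- by exists (mxvec S0); rewrite /B /= mxvecK.
- apply: continuous_subspaceT => u; apply: continuous_comp; last exact: cf.
  exact: continuous_vec_mx.
rewrite inE => Bu min_u; exists (vec_mx u) => // S' AS'.
by have := min_u (mxvec S'); rewrite /= mxvecK; apply; rewrite inE /B /= mxvecK.
Qed.

Lemma continuous_sumr (T : topologicalType) (I : finType) (P : pred I)
    (F : I -> T -> R) :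
  (forall i, continuous (F i)) -> continuous (fun x => \sum_(i | P i) F i x).
Proof.
by move=> cF; apply: continuous_big => //; exact: add_continuous.
Qed.

Lemma closed_eqr (T : topologicalType) (f g : T -> R) :
  continuous f -> continuous g -> closed [set x | f x = g x].
Proof.
move=> cf cg.
rewrite [X in closed X](_ : _ = (fun x => f x - g x) @^-1` [set x | x = 0]).
  apply: preimage_closed; last exact: closed_eq.
  by move=> x _; apply: (@continuousB _ R^o); [exact: cf | exact: cg].
by apply/seteqP; split=> x /= /eqP; [rewrite -subr_eq0|rewrite subr_eq0] =>
  /eqP.
Qed.

Lemma closed_ler (T : topologicalType) (f g : T -> R) :
  continuous f -> continuous g -> closed [set x | f x <= g x].
Proof.
move=> cf cg.
rewrite [X in closed X](_ : _ = (fun x => f x - g x) @^-1` [set x | x <= 0]).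
  apply: preimage_closed; last exact: closed_le.
  by move=> x _; apply: (@continuousB _ R^o); [exact: cf | exact: cg].
by apply/seteqP; split=> x /=; rewrite subr_le0.
Qed.

Lemma closed_forall (T : topologicalType) I (P : I -> T -> Prop) :
  (forall i, closed [set x | P i x]) -> closed [set x | forall i, P i x].
Proof.
move=> clP; rewrite [X in closed X](_ : _ = \bigcap_(i in setT) [set x | P i
  x]).
  by apply: closed_bigI => i _.
by apply/seteqP; split=> x /= h => [i _|i]; apply: h.
Qed.

End Compactness.

(** * Symplectic maps between positive diagonal matrices *)

Section Uniqueness.
Variable R : rcfType.

(** -J S^T J is a right inverse of S, hence also a left inverse. *)
Lemma sp_tr n (S : 'M[R]_(n + n)) : sp S -> S^T *m Jmx R n *m S = Jmx R n.
Proof.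
move=> hS; have e : - (Jmx R n *m S^T *m Jmx R n) *m S = 1%:M.
  by apply: mulmx1C; rewrite mulmxN !mulmxA hS mul_Jmx opprK.
have : Jmx R n *m (- (Jmx R n *m S^T *m Jmx R n) *m S) = Jmx R n.
  by rewrite e mulmx1.
by rewrite mulNmx mulmxN !mulmxA mul_Jmx !mulNmx mul1mx opprK.
Qed.

Lemma dbl_diag_J n (d : 'I_n -> R) :
  dbl_diag d *m Jmx R n = Jmx R n *m dbl_diag d.
Proof.
rewrite /dbl_diag diag_mx_row /Jmx !mulmx_block.
by rewrite !(mulmx0, mul0mx, addr0, add0r) mulmx1 mul1mx mulmxN mulNmx mulmx1
  mul1mx.
Qed.

Lemma posdefmx_dbl_diag n (d : 'I_n -> R) :
  (forall j, 0 < d j) -> posdefmx (dbl_diag d).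
Proof.
move=> d0 v /rV0Pn[a va].
have D0 b : 0 < (row_mx (\row_j d j) (\row_j d j)) 0 b.
  by case: (split_ordP b) => k ->; rewrite ?row_mxEl ?row_mxEr mxE d0.
rewrite /dbl_diag mul_mx_diag mxE; move: (row_mx _ _) D0 => w D0.
rewrite (bigD1 a) //=; apply: ltr_pwDl; last apply: sumr_ge0 => b _.
  by rewrite !mxE mulrAC -expr2 mulr_gt0 // exprn_even_gt0.
by rewrite !mxE mulrAC -expr2 mulr_ge0 ?sqr_ge0 // ltW.
Qed.

Lemma posdefmx_diag_entry n (G : 'M[R]_n) a : posdefmx G -> 0 < G a a.
Proof.
move=> /(_ (delta_mx 0 a)); rewrite -rowE trmx_delta -colE !mxE; apply.
by apply/rV0Pn; exists a; rewrite mxE !eqxx oner_eq0.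
Qed.

Lemma posdefmx_mxsub m n (f : 'I_m -> 'I_n) (G : 'M[R]_n) :
  injective f -> posdefmx G -> posdefmx (mxsub f f G).
Proof.
move=> f_inj G0 v v0; pose E : 'M[R]_(m, n) := rowsub f 1%:M.
have EET : E *m E^T = 1%:M.
  rewrite mul_rowsub_mx mul1mx; apply/matrixP => i j.
  by rewrite !mxE eq_sym (inj_eq f_inj).
have -> : mxsub f f G = E *m G *m E^T.
  rewrite mul_rowsub_mx mul1mx trmx_mxsub trmx1 mulmx_colsub mulmx1.
  by apply/matrixP => i j; rewrite !mxE.
have := G0 (v *m E); rewrite trmx_mul !mulmxA; apply.
apply: contraNneq v0 => vE; rewrite -[v]mulmx1 -EET mulmxA vE mul0mx //.
Qed.

Lemma posdefmx_unit n (G : 'M[R]_n) : posdefmx G -> G \in unitmx.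
Proof.
move=> G0; rewrite -row_free_unit -kermx_eq0; apply/rowV0P => v /sub_kermxP vG.
by apply: contraTeq isT => /G0; rewrite vG mul0mx mxE ltxx.
Qed.

(** From S^T J S = J one gets S D J = C J S, and applying this twice with J D J = -D gives S D^2 =
    C^2 S. Positivity allows taking roots, so S D = C S; then C S S^T = S D S^T = C, and C
    cancels. *)
Lemma sp_diag_orthogonal n (d c : 'I_n -> R) (S : 'M[R]_(n + n)) :
    (forall j, 0 < d j) -> sp S ->
    S *m dbl_diag d *m S^T = dbl_diag c ->
  S *m S^T = 1%:M /\ S^T *m S = 1%:M.
Proof.
move=> d0 spS SDS; set D := dbl_diag d in SDS *; set C := dbl_diag c in SDS *.
have C0 : posdefmx C.
  by rewrite -SDS; apply: posdefmx_congr; [exact: sp_unit | exact: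
    posdefmx_dbl_diag].
have SDJ : S *m D *m Jmx R n = C *m Jmx R n *m S.
  by rewrite -SDS -!mulmxA; congr (_ *m (_ *m _)); rewrite mulmxA sp_tr.
have SDD : S *m (D *m D) = C *m C *m S.
  have JDJ v : Jmx R n *m dbl_diag v *m Jmx R n = - dbl_diag v.
    by rewrite -dbl_diag_J -mulmxA mul_Jmx mulmxN mulmx1.
  transitivity (- (S *m D *m Jmx R n *m D *m Jmx R n)).
    by rewrite -!mulmxA (mulmxA (Jmx R n)) JDJ !mulmxN opprK.
  rewrite SDJ -(mulmxA _ S) -(mulmxA _ (S *m D)) SDJ !mulmxA.
  by rewrite -!(mulmxA C) JDJ mulNmx mulmxN opprK mulmxA.
have uC : C \in unitmx := posdefmx_unit C0.
(* Entrywise: wherever [S a b] is nonzero, the squares of the two diagonal entries agree, hence so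
   do the entries. *)
have SD : S *m D = C *m S.
  move: SDD (posdefmx_dbl_diag d0) C0; rewrite -/D /D /C /dbl_diag.
  move: (row_mx _ _) (row_mx _ _) => w u SDD Du Cw.
  apply/matrixP => a b; have := congr1 (fun M : 'M_(n + n) => M a b) SDD.
  have := posdefmx_diag_entry b Du; have := posdefmx_diag_entry a Cw.
  rewrite !mulmx_diag !mul_mx_diag !mul_diag_mx !mxE !eqxx !mulr1n => wa ub e.
  have [->|Sab] := eqVneq (S a b) 0; first by rewrite mul0r mulr0.
  have : u 0 b ^+ 2 = w 0 a ^+ 2 by apply: (mulfI Sab); rewrite !expr2 e mulrC.
  by move/eqP; rewrite eqrXn2 ?ltW // => /eqP ->; rewrite mulrC.
have SS : S *m S^T = 1%:M.
  have e : C *m (S *m S^T) = C *m 1%:M by rewrite mulmxA -SD SDS mulmx1.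
  by rewrite -[LHS]mul1mx -(mulVmx uC) -mulmxA e mulmxA mulVmx // mul1mx.
by split=> //; apply: mulmx1C.
Qed.

End Uniqueness.

(** * Majorisation under doubly stochastic matrices *)

Section DoublyStochastic.
Variables (R : realFieldType) (n : nat).
Variables (q : 'I_n.+1 -> 'I_n.+1 -> R) (d c : 'I_n.+1 -> R).
Hypotheses (q_ge0 : forall i j, 0 <= q i j) (q_row : forall i, \sum_j q i j = 1)
  (q_col : forall j, \sum_i q i j = 1) (cE : forall i, c i = \sum_j q i j * d j)
  (d_sorted : forall i j : 'I_n.+1, (i <= j)%N -> d i <= d j).

(** The first k + 1 rows give d the weights t_j in [0, 1], of total k + 1. Relative to [d k], a
    weight at most 1 on the smaller values and any nonnegative weight on the larger ones can only
    raise the sum. *)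
Lemma stochastic_psum (k : 'I_n.+1) :
  \sum_(j < n.+1 | (j <= k)%N) d j <= \sum_(j < n.+1 | (j <= k)%N) c j.
Proof.
pose t j := \sum_(i < n.+1 | (i <= k)%N) q i j.
have t_ge0 j : 0 <= t j by apply: sumr_ge0.
have t_le1 j : t j <= 1.
  by rewrite -(q_col j) [leRHS](bigID (fun i : 'I_n.+1 => (i
    <= k)%N)) /= lerDl sumr_ge0.
have -> : \sum_(j < n.+1 | (j <= k)%N) c j = \sum_j t j * d j.
  under eq_bigr do rewrite cE.
  by rewrite exchange_big /=; apply: eq_bigr => j _; rewrite mulr_suml.
have -> : \sum_j t j * d j = \sum_j t j * (d j - d k) + (\sum_j t j) * d k.
  by rewrite mulr_suml -big_split; apply: eq_bigr => j _ /=;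
    rewrite -mulrDr subrK.
have -> : \sum_j t j = \sum_(j < n.+1 | (j <= k)%N) 1.
  by rewrite exchange_big /=; apply: eq_bigr => i _; apply: q_row.
rewrite mulr_suml -lerBlDr -sumrB.
rewrite [leRHS](bigID (fun i : 'I_n.+1 => (i <= k)%N)) /= -[leLHS]addr0.
apply: lerD.
  apply: ler_sum => j jk; rewrite mul1r -[leLHS]mul1r; apply: ler_wnM2r => //.
  by rewrite subr_le0 d_sorted.
apply: sumr_ge0 => j; rewrite -ltnNge => jk; apply: mulr_ge0 => //.
by rewrite subr_ge0 d_sorted // ltnW.
Qed.

Lemma stochastic_sum : \sum_j c j = \sum_j d j.
Proof.
under eq_bigr do rewrite cE.
by rewrite exchange_big /=; apply: eq_bigr => j _;
  rewrite -mulr_suml q_col mul1r.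
Qed.

Lemma stochastic_max i : c i <= d ord_max.
Proof.
rewrite cE -[leRHS]mul1r -(q_row i) mulr_suml; apply: ler_sum => j _.
by apply: ler_wpM2l => //; apply: d_sorted; rewrite -ltnS.
Qed.

End DoublyStochastic.

Lemma sum_update (R : zmodType) n (P : pred 'I_n) (u u' : 'I_n -> R)
    (i k : 'I_n) :
    i != k -> (forall j, j != i -> j != k -> u' j = u j) ->
  \sum_(j | P j) u' j = \sum_(j | P j) u j
    + (u' i - u i) *+ P i + (u' k - u k) *+ P k.
Proof.
move=> ik eu.
have eP l : (u' l - u l) *+ P l = \sum_(j | P j) (u' l - u l) *+ (j == l).
  case Pl: (P l).
    by rewrite (bigD1 l) //= eqxx big1 ?addr0 // => j /andP[_ /negPf->].
  by rewrite big1 // => j Pj; case: eqP => // jl; rewrite -jl Pj in Pl.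
rewrite !eP -!big_split; apply: eq_bigr => j _ /=.
have [->|ji] := eqVneq j i; first by rewrite (negPf ik) mulr1n addr0 addrC
  subrK.
rewrite mulr0n addr0.
have [->|jk] := eqVneq j k; first by rewrite mulr1n addrC subrK.
by rewrite addr0 eu.
Qed.

(** * The minimisation over symplectic matrices *)

Section Necessity.
Local Open Scope classical_set_scope.
Variables (R : realType) (n : nat) (d : 'I_n.+1 -> R).
Hypothesis d_ge1 : forall j, 1 <= d j.
Let N := (n.+1 + n.+1)%N.
Implicit Types (S : 'M[R]_N) (j k : 'I_n.+1).

Let G S := S *m dbl_diag d *m S^T.
Let mode_val S j := G S (phase_ord false j) (phase_ord false j).
Let gap (v : 'I_n.+1 -> R) := v ord_max - \sum_(j < n.+1 | (j < n)%N) v j.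

(** The feasible set of the minimisation. All its conditions are closed, and the bounds involve only
    [c], so decoupling a pair of modes does not leave the set. *)
Definition spectra_set (c : 'I_n.+1 -> R) : set 'M[R]_N :=
  [set S | sp S /\ (forall j, normal_mode (G S) j (mode_val S j))] `&`
  [set S | forall k : 'I_n.+1, \sum_(j < n.+1 | (j <= k)%N) mode_val S j
               <= \sum_(j < n.+1 | (j <= k)%N) c j] `&`
  [set S | gap c <= gap (mode_val S)].

Lemma G_entry S a b :
  G S a b = \sum_e S a e * (row_mx (\row_j d j) (\row_j d j)) 0 e * S b e.
Proof.
by rewrite /G /dbl_diag mul_mx_diag mxE; apply: eq_bigr => e _; rewrite !mxE.
Qed.

Lemma G_sym S : (G S)^T = G S.
Proof. by rewrite /G !trmx_mul trmxK tr_diag_mx mulmxA. Qed.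

Lemma d_row_ge1 e : 1 <= (row_mx (\row_j d j) (\row_j d j)) 0 e.
Proof. by case: (split_ordP e) => k ->; rewrite ?row_mxEl ?row_mxEr mxE. Qed.

(** Since d >= 1, a diagonal entry of S D S^T dominates the sum of squares of the corresponding row
    of S; this is the source of compactness. *)
Lemma entry_le_G S a b : S a b ^+ 2 <= G S a a.
Proof.
rewrite G_entry (bigD1 b) //= -[leLHS]addr0; apply: lerD.
  by rewrite mulrAC -expr2 ler_peMr ?sqr_ge0 ?d_row_ge1.
apply: sumr_ge0 => e _; rewrite mulrAC -expr2 mulr_ge0 ?sqr_ge0 //.
by apply: le_trans (d_row_ge1 e).
Qed.

Lemma continuous_entry a b : continuous (fun S : 'M[R]_N => S a b).
Proof. exact: coord_continuous. Qed.

Lemma continuous_mulr (T : topologicalType) (f g : T -> R) :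
  continuous f -> continuous g -> continuous (fun x => f x * g x).
Proof. by move=> cf cg x; apply: (@continuousM R); [exact: cf | exact: cg]. Qed.

Lemma continuous_cstr (T : topologicalType) (x : R) :
  continuous (fun _ : T => x).
Proof. by move=> ?; apply: cst_continuous. Qed.

Lemma continuous_G a b : continuous (fun S => G S a b).
Proof.
under [X in continuous X]eq_fun do rewrite G_entry.
apply: continuous_sumr => e; apply: continuous_mulr;
  last exact: continuous_entry.
by apply: continuous_mulr; [exact: continuous_entry | exact: continuous_cstr].
Qed.

Lemma continuous_psum_val (P : pred 'I_n.+1) :
  continuous (fun S => \sum_(j < n.+1 | P j) mode_val S j).
Proof. by apply: continuous_sumr => j; exact: continuous_G. Qed.

Lemma closed_spectra_set c : closed (spectra_set c).
Proof.
have c_sp : closed [set S : 'M[R]_N | sp S].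
  have -> : [set S : 'M[R]_N | sp S] =
     [set S | forall a b, (S *m Jmx R n.+1 *m S^T) a b = Jmx R n.+1 a b].
    apply/seteqP; split=> S /= h; first by move=> a b; rewrite h.
    by apply/matrixP.
  apply: closed_forall => a; apply: closed_forall => b.
  apply: closed_eqr; last exact: continuous_cstr.
  have -> : (fun S => (S *m Jmx R n.+1 *m S^T) a b) =
     (fun S => \sum_e (\sum_e' S a e' * Jmx R n.+1 e' e) * S b e).
    by apply: funext => S; rewrite mxE; apply: eq_bigr => e _; rewrite !mxE.
  apply: continuous_sumr => e; apply: continuous_mulr;
    last exact: continuous_entry.
  apply: continuous_sumr => e'.
  by apply: continuous_mulr; [exact: continuous_entry | exact: continuous_cstr].
have c_norm : closed
    [set S : 'M[R]_N | forall j, normal_mode (G S) j (mode_val S j)].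
  apply: closed_forall => j; apply: closed_forall => p;
    apply: closed_forall => p'.
  apply: closed_eqr; first exact: continuous_G.
  by case: (p == p'); [exact: continuous_G | exact: continuous_cstr].
apply: closedI; first apply: closedI.
- exact: closedI.
- apply: closed_forall => k; apply: closed_ler; last exact: continuous_cstr.
  exact: continuous_psum_val.
apply: closed_ler; first exact: continuous_cstr.
move=> S; apply: (@continuousB _ R^o); first exact: continuous_G.
exact: continuous_psum_val.
Qed.

(** The partial sum over all modes bounds each local value, and x^2 <= s gives x <= 1 + s. *)
Lemma bounded_spectra_set c S a b : spectra_set c S ->
  `|S a b| <= 1 + \sum_j c j.
Proof.
move=> [[[spS norm_S] le_c] _].
have val_ge0 j : 0 <= mode_val S j by apply: le_trans (entry_le_G S _ 0);
  exact: sqr_ge0.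
have sum_le : \sum_j mode_val S j <= \sum_j c j.
  have sumE (u : 'I_n.+1 -> R) : \sum_(j < n.+1 | (j <= n)%N) u j = \sum_j u j.
    by apply: eq_bigl => j; exact: leq_ord.
  by have := le_c ord_max; rewrite /= !sumE.
have : S a b ^+ 2 <= \sum_j c j.
  apply: le_trans (entry_le_G _ _ _) _; have [p [j ->]] := phase_ordP a.
  rewrite norm_S eqxx mulr1n; apply: le_trans sum_le.
  by rewrite (bigD1 j) //= lerDl sumr_ge0.
rewrite -real_normK ?num_real //; have := normr_ge0 (S a b).
move: `|S a b| (\sum_j c j) => x y; nra.
Qed.

(** [two_mode_step] is applied to modes i and k, the smaller value p going to the smaller index: p
    <= a and p + q <= a + b make no partial sum grow. The gap inequality survives by q - p >= b - a
    if k is the last mode, and because the subtracted sum does not grow otherwise. *)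
Lemma spectra_step c S (i k : 'I_n.+1) : spectra_set c S -> (i < k)%N ->
  exists S', [/\ spectra_set c S',
    forall m : 'I_n.+1, \sum_(j < n.+1 | (j <= m)%N) mode_val S' j
                   <= \sum_(j < n.+1 | (j <= m)%N) mode_val S j
  & (forall m : 'I_n.+1, \sum_(j < n.+1 | (j <= m)%N) mode_val S' j
                   = \sum_(j < n.+1 | (j <= m)%N) mode_val S j) ->
    forall p p', G S (phase_ord p i) (phase_ord p' k) = 0].
Proof.
move=> [[[spS norm_S] le_c] gap_c] lt_ik.
have ik : i != k by rewrite -val_eqE neq_ltn lt_ik.
pose f := pair_ord i k; have f_inj : injective f := pair_ord_inj ik.
have G_pos : posdefmx (G S).
  apply: posdefmx_congr; first exact: sp_unit.
  by apply: posdefmx_dbl_diag => j; apply: lt_le_trans (d_ge1 j).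
have symG a b : G S a b = G S b a by rewrite -[in LHS]G_sym mxE.
pose x p p' := G S (phase_ord p i) (phase_ord p' k).
have GE : mxsub (dbl_ord f) (dbl_ord f) (G S) =
  two_mode_normal (mode_val S i) (mode_val S k) (x false false) (x false true)
    (x true false) (x true true).
  apply/matrixP => a b; rewrite mxE.
  have [p [t ->]] := phase_ordP a; have [p' [t' ->]] := phase_ordP b.
  rewrite !dbl_phase_ord /f /pair_ord.
  case: t => [[|[|//]] ?]; case: t' => [[|[|//]] ?];
    rewrite /= ?norm_S ?(symG (phase_ord _ k));
  case: p; case: p'; rewrite /= ?block_mxEul ?block_mxEdr ?block_mxEur
    ?block_mxEdl [RHS]mxE //=.
have H_pos := posdefmx_mxsub (dbl_ord_inj f_inj) G_pos; rewrite GE in H_pos.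
have [T [p [q [spT TE [pi pk pq] [d1 d2] zero]]]] := two_mode_step H_pos.
pose S' := embed f T *m S; exists S'.
have spS' : sp S' by apply: preserves_mul; [exact: sp_embed | ].
have GS' : G S' = embed f T *m G S *m (embed f T)^T by rewrite /G /S' trmx_mul
  !mulmxA.
have pairE t p0 p1 : G S' (phase_ord p0 (f t)) (phase_ord p1 (f t))
    = (if t == 0 then p else q) *+ (p0 == p1).
  rewrite -!(dbl_phase_ord f) GS'.
  have := embed_congr_dbl f_inj T (G S); rewrite GE TE => /matrixP.
  move=> /(_ (phase_ord p0 t) (phase_ord p1 t)); rewrite mxE => ->.
  case: t => [[|[|//]] ?]; case: p0; case: p1;
    by rewrite /= ?block_mxEul ?block_mxEdr ?block_mxEur ?block_mxEdl !mxE.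
have otherE j p0 p1 : j != i -> j != k ->
    G S' (phase_ord p0 j) (phase_ord p1 j)
      = G S (phase_ord p0 j) (phase_ord p1 j).
  move=> ji jk; rewrite GS' embed_congr_id //; apply: dbl_ord_neq => t;
    by rewrite /f /pair_ord; case: (t == 0); rewrite eq_sym.
have v_i : mode_val S' i = p by have := pairE 0 false false.
have v_k : mode_val S' k = q by have := pairE 1 false false.
have v_o j : j != i -> j != k -> mode_val S' j = mode_val S j by apply: otherE.
have upd P := sum_update P ik v_o; rewrite v_i v_k in upd.
have le_m m : \sum_(j < n.+1 | (j <= m)%N) mode_val S' j
    <= \sum_(j < n.+1 | (j <= m)%N) mode_val S j.
  rewrite upd; case: (leqP k m) => km; first by rewrite (ltnW (leq_trans lt_ik
    km)) !mulr1n; lra.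
  by case: (leqP i m) => im; rewrite ?mulr1n ?mulr0n; lra.
split=> //.
- split; first split.
  + split=> // j p0 p1.
    have [->|ji] := eqVneq j i; first by rewrite v_i; exact: (pairE 0).
    have [->|jk] := eqVneq j k; first by rewrite v_k; exact: (pairE 1).
    by rewrite otherE // norm_S v_o.
  + by move=> m; apply: le_trans (le_m m) (le_c m).
  + apply: le_trans gap_c _; rewrite /gap /= upd.
    have i_n : (i < n)%N by apply: leq_trans lt_ik _; rewrite -ltnS.
    rewrite i_n mulr1n.
    have [kmax|kmax] := eqVneq k ord_max.
      by rewrite -kmax v_k kmax ltnn mulr0n; move: d2; rewrite kmax; lra.
    have -> : (k < n)%N by rewrite ltn_neqAle -ltnS ltn_ord andbT; move: kmax;
      rewrite -val_eqE.
    rewrite v_o 1?eq_sym //; last by rewrite -val_eqE /= ltn_eqF.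
    by rewrite mulr1n; lra.
(* The partial sum up to i isolates the change of mode i, and the one up to k then that of mode
   k. *)
- move=> eq_m.
  have e_i := eq_m i; rewrite upd leqnn leqNgt lt_ik mulr0n mulr1n in e_i.
  have e_k := eq_m k; rewrite upd leqnn (ltnW lt_ik) !mulr1n in e_k.
  have [|| x1 x2 x3 x4] := zero; [lra | lra |].
  by move=> [] [].
Qed.

Lemma spectra_necessary (S0 : 'M[R]_N) (c : 'I_n.+1 -> R) :
    (forall i j : 'I_n.+1, (i <= j)%N -> d i <= d j) ->
    sp S0 -> (forall j, normal_mode (G S0) j (c j)) ->
  (forall k : 'I_n.+1, \sum_(j < n.+1 | (j <= k)%N) d j
     <= \sum_(j < n.+1 | (j <= k)%N) c j) /\ gap c <= gap d.
Proof.
move=> d_sorted spS0 norm0.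
have vS0 : mode_val S0 = c by apply: funext => j; rewrite /mode_val norm0.
have S0c : spectra_set c S0.
  by split; first split; rewrite /= ?vS0.
(* Lowering one partial sum without raising another lowers [Phi]. *)
pose Phi S := \sum_(m < n.+1) \sum_(j < n.+1 | (j <= m)%N) mode_val S j.
have cPhi : continuous Phi.
  by apply: (continuous_sumr (P := predT)) => m; exact: continuous_psum_val.
have [S Sc minS] := matrix_EVT_min (ex_intro _ S0 S0c) (@closed_spectra_set c)
  (fun S Sc a b => @bounded_spectra_set c S a b Sc) cPhi.
have [[[spS norm_S] le_c] gap_c] := Sc.
(* At the minimum a decoupling step changes no partial sum, so there was no correlation to
   remove. *)
have off (i k : 'I_n.+1) p p' :
  (i < k)%N -> G S (phase_ord p i) (phase_ord p' k) = 0.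
  move=> ik; have [S' [S'c le_m]] := spectra_step Sc ik; apply.
  have dif_ge0 (m : 'I_n.+1) : true ->
      0 <= \sum_(j < n.+1 | (j <= m)%N) mode_val S j
                 - \sum_(j < n.+1 | (j <= m)%N) mode_val S' j.
    by rewrite subr_ge0 le_m.
  have sum0 : \sum_(m < n.+1) (\sum_(j < n.+1 | (j <= m)%N) mode_val S j
                 - \sum_(j < n.+1 | (j <= m)%N) mode_val S' j) = 0.
    apply/le_anti; rewrite sumr_ge0 // andbT sumrB subr_le0.
    exact: minS.
  by move=> m; apply/esym/eqP; rewrite -subr_eq0; apply/eqP;
    apply: (psumr_eq0P dif_ge0).
have SDS : S *m dbl_diag d *m S^T = dbl_diag (mode_val S).
  apply/matrixP => a b; have [p [i ->]] := phase_ordP a.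
  have [p' [k ->]] := phase_ordP b; rewrite dbl_diagE.
  have [->|ik] := eqVneq i k; first by rewrite andbT; exact: norm_S.
  rewrite andbF mulr0n; move: ik; rewrite -val_eqE neq_ltn => /orP[ik|ki].
    exact: off.
  by rewrite -/(G S) -G_sym mxE; apply: off.
have d0 j : 0 < d j by apply: lt_le_trans (d_ge1 j).
have [SS StS] := sp_diag_orthogonal d0 spS SDS.
(* Half the sum of squares of the 2 x 2 block joining modes i and j. Orthogonality of S makes it
   doubly stochastic, and averaging the position and momentum diagonal entries of mode i gives
   [vE]. *)
pose q i j := (\sum_p \sum_p' S (phase_ord p i) (phase_ord p' j) ^+ 2) / 2.
have sumN (F : 'I_N -> R) : \sum_e F e = \sum_j \sum_p F (phase_ord p j).
  rewrite big_split_ord /= -big_split /=; apply: eq_bigr => j _.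
  by rewrite big_bool addrC.
have row_norm a : \sum_e S a e ^+ 2 = 1.
  have := congr1 (fun M : 'M_N => M a a) SS; rewrite /= !mxE eqxx => /(etrans
    _); apply.
  by apply: eq_bigr => e _; rewrite mxE expr2.
have col_norm a : \sum_e S e a ^+ 2 = 1.
  have := congr1 (fun M : 'M_N => M a a) StS; rewrite /= !mxE eqxx => /(etrans
    _); apply.
  by apply: eq_bigr => e _; rewrite mxE expr2.
have q_ge0 i j : 0 <= q i j.
  by rewrite divr_ge0 //; do 2 (apply: sumr_ge0 => ? _); exact: sqr_ge0.
have q_row i : \sum_j q i j = 1.
  rewrite -mulr_suml exchange_big /= big_bool /=.
  rewrite -(sumN (fun e => S (phase_ord true i) e ^+ 2)).
  by rewrite -(sumN (fun e => S (phase_ord false i) e ^+ 2)) !row_norm; field.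
have q_col j : \sum_i q i j = 1.
  rewrite -mulr_suml; under eq_bigr do rewrite exchange_big.
  rewrite exchange_big /= big_bool /=.
  rewrite -(sumN (fun e => S e (phase_ord true j) ^+ 2)).
  by rewrite -(sumN (fun e => S e (phase_ord false j) ^+ 2)) !col_norm; field.
have vE i : mode_val S i = \sum_j q i j * d j.
  have v2 p : mode_val S i
    = \sum_j (\sum_p' S (phase_ord p i) (phase_ord p' j) ^+ 2) * d j.
    have -> : mode_val S i = G S (phase_ord p i) (phase_ord p i) by rewrite
      norm_S eqxx.
    rewrite G_entry sumN; apply: eq_bigr => j _; rewrite mulr_suml.
    apply: eq_bigr => p' _; rewrite mulrAC -expr2; congr (_ * _).
    by case: p' => /=; rewrite ?row_mxEl ?row_mxEr mxE.
  have : mode_val S i = (mode_val S i + mode_val S i) / 2 by field.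
  rewrite {2}(v2 true) {2}(v2 false) -big_split mulr_suml => ->.
  by apply: eq_bigr => j _ /=; rewrite /q !big_bool /=; ring.
split=> [k|].
  exact: le_trans (stochastic_psum q_ge0 q_row q_col vE d_sorted k) (le_c k).
apply: le_trans gap_c _.
(* Written as twice the last value minus the total, the gap is monotone in the last value, as the
   total is preserved. *)
have gapE (v : 'I_n.+1 -> R) : gap v = v ord_max *+ 2 - \sum_j v j.
  have -> : \sum_j v j = v ord_max + \sum_(j < n.+1 | (j < n)%N) v j.
    rewrite (bigD1 ord_max) //=; congr (_ + _); apply: eq_bigl => j.
    by rewrite -val_eqE /= [RHS]ltn_neqAle -ltnS ltn_ord andbT.
  by rewrite /gap; ring.
rewrite !gapE (stochastic_sum q_col vE) lerD2r lerMn2r /=.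
exact: (stochastic_max q_ge0 q_row vE d_sorted).
Qed.

End Necessity.

(** * From interleaved to block phase-space coordinates *)

Section PhaseSpace.
Local Open Scope sesquilinear_scope.
Variable R : realType.

Definition quad_ord (p : bool) : 'I_2 := if p then 1 else 0.

Lemma quad_ordP (a : 'I_2) : exists p, a = quad_ord p.
Proof.
by case: a => [[|[|//]] i]; [exists false | exists true]; apply: val_inj.
Qed.

Definition interleave n (i : 'I_(n + n)) : 'I_(phase_dim n) :=
  match split i with
  | inl j => @tagnat.Rank n (fun=> 2) j 0
  | inr j => @tagnat.Rank n (fun=> 2) j 1
  end.

Definition separate n (s : 'I_(phase_dim n)) : 'I_(n + n) :=
  phase_ord (tagnat.sig2 s == 1 :> nat) (tagnat.sig1 s).

Lemma interleaveE n p (j : 'I_n) :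
  interleave (phase_ord p j) = @tagnat.Rank n (fun=> 2) j (quad_ord p).
Proof.
rewrite /interleave; case: p => /=.
  by rewrite (unsplitK (inr j)).
by rewrite (unsplitK (inl j)).
Qed.

Lemma interleaveK n : cancel (@interleave n) (@separate n).
Proof.
move=> i; have [p [j ->]] := phase_ordP i; rewrite interleaveE /separate.
by rewrite tagnat.Rank1K tagnat.Rank2K /=; case: p.
Qed.

Lemma separateK n : cancel (@separate n) (@interleave n).
Proof.
move=> s; rewrite /separate interleaveE -[RHS]tagnat.sig2K; congr tagnat.Rank.
by apply: val_inj; case: (tagnat.sig2 s) => [[|[|//]] i].
Qed.

Lemma mxsub_mul_bij m n (f : 'I_m -> 'I_n) (A B : 'M[R]_n) : bijective f ->
  mxsub f f (A *m B) = mxsub f f A *m mxsub f f B.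
Proof.
move=> f_bij; apply/matrixP => i j; rewrite !mxE (reindex f) /=;
  last exact: onW_bij.
by apply: eq_bigr => k _; rewrite !mxE.
Qed.

(** Conjugation by the permutation listing positions before momenta; it respects products and
    transposes and sends [sigma] to [Jmx]. *)
Definition to_blocks n (A : 'M[R]_(phase_dim n)) : 'M[R]_(n + n) :=
  mxsub (@interleave n) (@interleave n) A.

Lemma interleave_bij n : bijective (@interleave n).
Proof. by exists (@separate n); [exact: interleaveK | exact: separateK]. Qed.

Lemma to_blocks_mul n (A B : 'M[R]_(phase_dim n)) :
  to_blocks (A *m B) = to_blocks A *m to_blocks B.
Proof. exact: mxsub_mul_bij (interleave_bij n). Qed.

Lemma to_blocks_tr n (A : 'M[R]_(phase_dim n)) :
  to_blocks A^T = (to_blocks A)^T.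
Proof. by rewrite /to_blocks trmx_mxsub. Qed.

Lemma to_blocks_inj n : injective (@to_blocks n).
Proof.
move=> A B e; apply/matrixP => i j; have /matrixP/(_ (separate i) (separate
  j)) := e.
by rewrite !mxE !separateK.
Qed.

Lemma to_blocks_surj n (B : 'M[R]_(n + n)) : exists A, to_blocks A = B.
Proof.
exists (mxsub (@separate n) (@separate n) B).
by apply/matrixP => i j; rewrite !mxE !interleaveK.
Qed.

Lemma to_blocksE n (A : 'M[R]_(phase_dim n)) p p' j k :
  to_blocks A (phase_ord p j) (phase_ord p' k)
  = submxblock A j k (quad_ord p) (quad_ord p').
Proof. by rewrite !mxE !interleaveE. Qed.

Lemma submxblock_mxdiag n (B : 'I_n -> 'M[R]_2) j k :
  submxblock (\mxdiag_(i < n) B i) j k = if j == k then B j else 0.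
Proof.
by rewrite mxblockK; case: eqVneq => // e; rewrite e conform_mx_id.
Qed.

Lemma to_blocks_sigma n : to_blocks (sigma R n) = Jmx R n.
Proof.
apply/matrixP => i j; have [p [k ->]] := phase_ordP i;
  have [p' [l ->]] := phase_ordP j.
rewrite to_blocksE submxblock_mxdiag /Jmx.
by case: p; case: p'; rewrite /= ?block_mxEul ?block_mxEdr ?block_mxEur
  ?block_mxEdl;
  case: eqVneq => [->|/negPf kl]; rewrite !mxE ?eqxx ?kl /= ?subr0 ?sub0r
    ?subrr ?oppr0.
Qed.

Lemma to_blocks_diag n (d : 'I_n -> R) :
  to_blocks (\mxdiag_(k < n) ((d k)%:M : 'M[R]_2)) = dbl_diag d.
Proof.
apply/matrixP => i j; have [p [k ->]] := phase_ordP i;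
  have [p' [l ->]] := phase_ordP j.
rewrite to_blocksE submxblock_mxdiag dbl_diagE.
by case: eqVneq => kl; rewrite !mxE ?andbF //; case: p; case: p'.
Qed.

Lemma normal_modeP n (A : 'M[R]_(phase_dim n)) k c :
  normal_mode (to_blocks A) k c <-> submxblock A k k = c%:M.
Proof.
split=> [h|h p p'].
  apply/matrixP => a b; have [p ->] := quad_ordP a; have [p' ->] := quad_ordP b.
  by rewrite -to_blocksE h mxE; case: p; case: p'.
by rewrite to_blocksE h mxE; case: p; case: p'.
Qed.

Lemma symplecticP n (S : 'M[R]_(phase_dim n)) :
  symplectic S <-> sp (to_blocks S).
Proof.
rewrite /symplectic /sp /preserves -to_blocks_sigma -to_blocks_tr
  -!to_blocks_mul.
by split=> [->|/to_blocks_inj].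
Qed.

Lemma sigma_unit n : sigma R n \in unitmx.
Proof.
have /mulmx1_unit[] // : sigma R n *m (- sigma R n) = 1%:M.
apply: to_blocks_inj; rewrite mulmxN -[LHS](_ : - to_blocks (sigma R n *m
  sigma R n) = _).
  rewrite to_blocks_mul to_blocks_sigma mul_Jmx opprK.
  by apply/matrixP => i j; rewrite !mxE (can_eq (@interleaveK n)).
by apply/matrixP => i j; rewrite !mxE.
Qed.

Lemma mxdiag_congr n (A : 'M[R]_(phase_dim n)) (w : 'I_n -> 'M[R]_2) k l :
  submxblock (\mxdiag_(i < n) w i *m A *m (\mxdiag_(i < n) w i)^T) k l
  = w k *m submxblock A k l *m (w l)^T.
Proof.
rewrite -[A in LHS]submxblockK tr_mxdiag mul_mxdiag_mxblock mul_mxblock_mxdiag.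
by rewrite mxblockK.
Qed.

Lemma symplectic_mxdiag n (w : 'I_n -> 'M[R]_2) :
  (forall k, w k *m omega R *m (w k)^T = omega R) ->
  symplectic (\mxdiag_(k < n) w k).
Proof.
move=> hw; rewrite /symplectic -[LHS]submxblockK -[RHS]submxblockK.
apply: eq_mxblock => k l; rewrite mxdiag_congr submxblock_mxdiag.
by case: eqVneq => [->|_]; rewrite ?hw // mulmx0 mul0mx.
Qed.

Lemma submxblock1_congr (A B : 'M[R]_(phase_dim 1)) :
  submxblock (A *m B *m A^T) 0 0
  = submxblock A 0 0 *m submxblock B 0 0 *m (submxblock A 0 0)^T.
Proof.
rewrite -[A in LHS]submxblockK -[B in LHS]submxblockK tr_mxblock !mul_mxblock
  mxblockK.
by rewrite !big_ord1.
Qed.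

Lemma psdmx_congr n (M : 'M[R[i]]_n) (A : 'M[R]_n) : psdmx M ->
  psdmx (map_mx (real_complex R) A *m M *m (map_mx (real_complex R) A)^T).
Proof.
move=> M0 v; set A' := map_mx _ A; have := M0 (A'^T *m v).
have -> : (A'^T *m v) ^t* = v ^t* *m A'.
  rewrite trmx_mul trmxK map_mxM; congr (_ *m _).
  by apply/matrixP => i j; rewrite !mxE; apply/eqP;
    rewrite eq_complex /= oppr0 !eqxx.
by rewrite !mulmxA.
Qed.

Lemma uncertainty_congr n (g S : 'M[R]_(phase_dim n)) : symplectic S ->
  uncertainty (S *m g *m S^T)
  = map_mx (real_complex R) S *m uncertainty g *m (map_mx (real_complex R) S)^T.
Proof.
move=> spS; rewrite /uncertainty mulmxDr mulmxDl -scalemxAr -scalemxAl.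
by rewrite !matrix.map_trmx -!map_mxM spS.
Qed.

(** The vector (1, i) on mode k gives the form the value 2 (d_k - 1). *)
Lemma uncertainty_diag_ge1 n (d : 'I_n -> R) (k : 'I_n) :
  psdmx (uncertainty (\mxdiag_(j < n) ((d j)%:M : 'M[R]_2))) -> 1 <= d k.
Proof.
move=> /(psdmx_sub (@tagnat.Rank n (fun=> 2) k)).
set M := mxsub _ _ _ => M0.
have ME a b : M a b = ((d k)%:M a b)%:C%C + 'i%C * (omega R a b)%:C%C.
  transitivity ((submxblock (\mxdiag_(j < n) ((d j)%:M : 'M[R]_2)) k k a b)%:C%C
    + 'i%C * (submxblock (sigma R n) k k a b)%:C%C); first by rewrite !mxE.
  by rewrite !submxblock_mxdiag eqxx.
move: M ME M0 => M ME /(_ (\col_(a < 2) if a == 0 then 1 else 'i%C)).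
rewrite !mxE !big_ord_recl !big_ord0 !mxE !big_ord_recl !big_ord0 !ME !mxE /=.
rewrite lecE /= => /andP[_].
rewrite !(mulr0, mul0r, mulr1, mul1r, addr0, add0r, subr0, sub0r, oppr0,
  mulr0n, mulr1n).
lra.
Qed.

End PhaseSpace.

(** * Assembly of the equivalence *)

Lemma psum_inord (R : realFieldType) n (d : 'I_n.+1 -> R) (k : nat) :
  (k <= n)%N ->
  psum (fun i => d (inord i)) k.+1 = \sum_(j < n.+1 | (j <= k)%N) d j.
Proof.
move=> kn; rewrite /psum (big_ord_widen n.+1 (fun i => d (inord i))) //.
by apply: eq_bigr => j _; rewrite inord_val.
Qed.

Lemma spectra_condE (R : realFieldType) n (c d : 'I_n.+1 -> R) :
    (forall i j : 'I_n.+1, (i <= j)%N -> d i <= d j) ->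
    (forall i j : 'I_n.+1, (i <= j)%N -> c i <= c j) ->
    (forall k : 'I_n.+1,
      \sum_(j < n.+1 | (j <= k)%N) d j <= \sum_(j < n.+1 | (j <= k)%N) c j) ->
    c ord_max - \sum_(j < n.+1 | (j < n)%N) c j
      <= d ord_max - \sum_(j < n.+1 | (j < n)%N) d j ->
  spectra_cond n (fun i => c (inord i)) (fun i => d (inord i)).
Proof.
move=> hd hc hs hl; split.
- by move=> i j /andP[ij jn]; apply: hc; rewrite !inordK ?ltnS // (leq_trans
    ij jn).
- by move=> i j /andP[ij jn]; apply: hd; rewrite !inordK ?ltnS // (leq_trans
    ij jn).
- case=> [|j] jn; first by rewrite !psum0.
  by rewrite !psum_inord //; have := hs (Ordinal jn).
have inn : inord n = ord_max :> 'I_n.+1 by apply: val_inj; rewrite /= inordK.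
have E (v : 'I_n.+1 -> R) : psum (fun i => v (inord i)) n
  = \sum_(j < n.+1 | (j < n)%N) v j.
  rewrite /psum (big_ord_widen n.+1 (fun i => v (inord i))) //.
  by apply: eq_bigr => j _; rewrite inord_val.
by rewrite !E inn.
Qed.

Theorem corollary1 (R : realType) (n : nat) (d c : 'I_n.+1 -> R)
    (rho_ : 'I_n.+1 -> gaussian_state R 1)
    (d_sspec : exists rho0 : gaussian_state R n.+1, has_sspec rho0 d)
    (d_sorted : forall i j : 'I_n.+1, (i <= j)%N -> d i <= d j)
    (c_sspec : forall k : 'I_n.+1, has_sspec (rho_ k) (fun _ : 'I_1 => c k))
    (c_sorted : forall i j : 'I_n.+1, (i <= j)%N -> c i <= c j) :
  (exists rho : gaussian_state R n.+1,
     has_sspec rho d /\ forall k : 'I_n.+1, reduced_state rho k = rho_ k)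
  <->
  (forall k : 'I_n.+1,
     \sum_(j < n.+1 | (j <= k)%N) d j <= \sum_(j < n.+1 | (j <= k)%N) c j) /\
  c ord_max - \sum_(j < n.+1 | (j < n)%N) c j
    <= d ord_max - \sum_(j < n.+1 | (j < n)%N) d j.
Proof.
(* The normal form of [rho0]: symplectic congruence preserves the uncertainty relation, which then
   yields d >= 1. *)
pose D := \mxdiag_(k < n.+1) ((d k)%:M : 'M[R]_2).
have D_psd : psdmx (uncertainty D).
  have [rho0 [S0 [spS0 S0D]]] := d_sspec; rewrite /D -S0D uncertainty_congr //.
  by apply: psdmx_congr; exact: cov_uncertainty.
have d_ge1 k : 1 <= d k by exact: uncertainty_diag_ge1 D_psd.
have /choice[T_ hT] : forall k, exists T : 'M[R]_(phase_dim 1), symplectic T /\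
    T *m cov (rho_ k) *m T^T = \mxdiag_(i < 1) ((c k)%:M : 'M[R]_2) := c_sspec.
(* [t k] normalises the covariance [h k] of the k-th given state to c_k 1; their direct sum [W] acts
   locally on all modes. *)
pose t k := submxblock (T_ k) 0 0 : 'M[R]_2.
pose h k := submxblock (cov (rho_ k)) 0 0 : 'M[R]_2.
have t_sp k : t k *m omega R *m (t k)^T = omega R.
  have [spT _] := hT k; have := congr1 (fun M => submxblock M 0 0) spT.
  by rewrite submxblock1_congr /sigma submxblock_mxdiag eqxx.
have th k : t k *m h k *m (t k)^T = (c k)%:M.
  have [_ TE] := hT k; have := congr1 (fun M => submxblock M 0 0) TE.
  by rewrite submxblock1_congr submxblock_mxdiag eqxx.
pose W := \mxdiag_(k < n.+1) t k.
have spW : symplectic W by exact: symplectic_mxdiag.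
have J_unit := sigma_unit R n.+1.
split.
  move=> [rho [[S [spS SD]] red]].
  have hk k : submxblock (cov rho) k k = h k.
    have := congr1 (fun r => submxblock (cov r) 0 0) (red k).
    by rewrite /= /reduced_cov submxblock_mxdiag eqxx.
  have uS := preserves_unit J_unit spS.
  (* [V] carries [D] to the locally normalised covariance of [rho], whose diagonal blocks are c_k
     1. *)
  pose V := W *m invmx S.
  have spV : symplectic V.
    by apply: preserves_mul => //; exact: preserves_inv.
  have VD : V *m D *m V^T = W *m cov rho *m W^T.
    rewrite /V /D -SD trmx_mul trmx_inv !mulmxA mulmxKV // -(mulmxA _ S^T)
      mulmxV ?mulmx1 //.
    by rewrite unitmx_tr.
  apply: (spectra_necessary d_ge1 (S0 := to_blocks V)) => //;
    first exact/symplecticP.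
  move=> k; rewrite -to_blocks_diag -to_blocks_tr -!to_blocks_mul VD.
  by apply/normal_modeP; rewrite mxdiag_congr hk th.
move=> [h1 h2].
have cond := spectra_condE d_sorted c_sorted h1 h2.
have d0 : 0 < d (inord 0) by apply: lt_le_trans (d_ge1 _).
have [V0 [spV0 V0c]] := spectra_cond_sufficient cond d0.
have [V V_V0] := to_blocks_surj V0.
have spV : symplectic V by apply/symplecticP; rewrite V_V0.
have VD k : submxblock (V *m D *m V^T) k k = (c k)%:M.
  apply/normal_modeP; rewrite !to_blocks_mul to_blocks_tr to_blocks_diag V_V0.
  have -> : dbl_diag d = dbl_diag (fun j : 'I_n.+1 => d (inord j)).
    by congr dbl_diag; apply: funext => j; rewrite inord_val.
  by have := V0c k; rewrite inord_val.
(* [Wi] undoes the local normalisations, turning each block c_k 1 back into [h k]. *)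
pose Wi := \mxdiag_(k < n.+1) invmx (t k).
have om_unit : omega R \in unitmx.
  have /mulmx1_unit[] // : omega R *m (- omega R) = 1%:M.
  by apply/matrixP => a b; rewrite !mxE !big_ord_recl big_ord0 !mxE;
    case: a => [[|[|//]] ?]; case: b => [[|[|//]] ?]; rewrite /=; ring.
have ut k : t k \in unitmx := preserves_unit om_unit (t_sp k).
have spWi : symplectic Wi.
  by apply: symplectic_mxdiag => k; apply: (preserves_inv om_unit); exact: t_sp.
have [U [spU UE]] : exists U, symplectic U /\ U = Wi *m V.
  by exists (Wi *m V); split=> //; exact: preserves_mul.
pose g := U *m D *m U^T.
have g_sym : g^T = g.
  have DT : D^T = D.
    by rewrite /D tr_mxdiag; apply: eq_mxdiag => k; rewrite tr_scalar_mx.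
  by rewrite /g trmx_mul trmxK trmx_mul DT mulmxA.
have g_psd : psdmx (uncertainty g).
  by rewrite (uncertainty_congr _ spU); exact: psdmx_congr D_psd.
(* First moments are unconstrained, so those of the given states are stacked. *)
pose mu := \mxcol_(k < n.+1) submxcol (mean (rho_ k)) 0.
exists (GaussianState mu g_sym g_psd); split.
  exists (invmx U); split; first exact: preserves_inv.
  have uU := preserves_unit J_unit spU.
  by rewrite /= /g trmx_inv !mulmxA mulVmx // mul1mx mulmxK // unitmx_tr.
move=> k; apply: gaussian_state_eq => /=.
  by rewrite /reduced_mean /mu mxcolK; apply/esym; rewrite -[LHS]submxcolK;
    apply: eq_mxcol => i; rewrite ord1.
rewrite /reduced_cov -[RHS]submxblockK.
apply: eq_mxblock => i j; rewrite !ord1 eqxx conform_mx_id.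
rewrite /g UE trmx_mul !mulmxA -(mulmxA Wi) -(mulmxA Wi) mxdiag_congr VD.
rewrite -(th k) trmx_inv !mulmxA mulVmx // mul1mx mulmxK // unitmx_tr //.
Qed.
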